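(* Every c.e.\ orbit equivalence relation is computably bireducible with exactly one of $=^{ce}$ or $E_0^{ce}$.
   Context: Let $(W_e)_{e\in\omega}$ be a standard uniform enumeration of all computably enumerable (c.e.) subsets of $\omega$, and let $\mathbf{CE}$ be the collection of c.e.\ subsets of $\omega$. For equivalence relations $E,F$ on $\omega$, $E\le_c F$ ($E$ is computably reducible to $F$) means there is a computable $f$ with $x\,E\,y \iff f(x)\,F\,f(y)$; $E\equiv_c F$ (computably bireducible) means $E\le_c F$ and $F\le_c E$. The relation $=^{ce}$ on $\omega$ is $i =^{ce} j \iff W_i=W_j$; the relation $E_0^{ce}$ on $\omega$ is $i\,E_0^{ce}\,j \iff W_i\,\triangle\,W_j$ is finite. An action of a computable group $G$ on $\mathbf{CE}$ (acting on sets, not indices) is computable in indices if there is a computable $\alpha:G\times\omega\to\omega$ with $W_{\alpha(\gamma,e)}=\gamma\cdot W_e$ for all $\gamma\in G$, $e\in\omega$. A c.e.\ orbit equivalence relation is an equivalence relation $E^{ce}_G$ on $\omega$ of the form $i\,E^{ce}_G\,j\iff(\exists\gamma\in G)(\gamma\cdot W_i=W_j)$ for such an action computable in indices. *)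

(* Defs.v *)
From Stdlib Require Import Arith List Classical.
From Stdlib Require Cantor.

(** * Partial computable functions

    Programs for partial functions [nat -> nat]; several arguments are passed
    through Cantor pairing. Pairing and its projections being primitive
    recursive, these are exactly Kleene's mu-recursive functions. *)

Definition cpair (x y : nat) : nat := Cantor.to_nat (x, y).

Inductive code : Set :=
| Zero : code
| Succ : code
| Fst  : code
| Snd  : code
| Pair : code -> code -> code
| Comp : code -> code -> code
| Prec : code -> code -> code
| Mu   : code -> code.

(** [eval c x y]: program [c] halts on input [x] with output [y].
    [Prec f g] computes [h] with [h <x,0> = f x] and
    [h <x,k+1> = g <x,<k,h <x,k>>>]; [Mu f] sends [x] to the least [y] with
    [f <x,y> = 0], all earlier values being defined. *)
Fixpoint eval (c : code) : nat -> nat -> Prop :=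
  match c with
  | Zero => fun _ y => y = 0
  | Succ => fun x y => y = S x
  | Fst => fun x y => y = fst (Cantor.of_nat x)
  | Snd => fun x y => y = snd (Cantor.of_nat x)
  | Pair f g => fun x y =>
      exists a b, eval f x a /\ eval g x b /\ y = cpair a b
  | Comp f g => fun x y => exists z, eval g x z /\ eval f z y
  | Prec f g => fun p =>
      let x := fst (Cantor.of_nat p) in
      let n := snd (Cantor.of_nat p) in
      nat_rect (fun _ => nat -> Prop)
        (eval f x)
        (fun k R y => exists r, R r /\ eval g (cpair x (cpair k r)) y)
        n
  | Mu f => fun x y =>
      eval f (cpair x y) 0 /\
      (forall z, z < y -> exists v, eval f (cpair x z) (S v))
  end.

Definition computable_on (D : nat -> Prop) (f : nat -> nat) : Prop :=
  exists c, forall x, D x -> eval c x (f x).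

Definition computable (f : nat -> nat) : Prop :=
  computable_on (fun _ => True) f.

Definition computable2_on (D : nat -> nat -> Prop) (f : nat -> nat -> nat)
  : Prop :=
  exists c, forall x y, D x y -> eval c (cpair x y) (f x y).

Definition computable_set (A : nat -> Prop) : Prop :=
  exists chi : nat -> bool,
    computable (fun x => Nat.b2n (chi x)) /\ (forall x, A x <-> chi x = true).

(** * Computably enumerable sets *)

Definition set_eq (A B : nat -> Prop) : Prop := forall x, A x <-> B x.

Definition is_ce (A : nat -> Prop) : Prop :=
  exists c, forall x, A x <-> exists y, eval c x y.

Fixpoint encode (c : code) : nat :=
  match c with
  | Zero => cpair 0 0
  | Succ => cpair 1 0
  | Fst => cpair 2 0
  | Snd => cpair 3 0
  | Pair f g => cpair 4 (cpair (encode f) (encode g))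
  | Comp f g => cpair 5 (cpair (encode f) (encode g))
  | Prec f g => cpair 6 (cpair (encode f) (encode g))
  | Mu f => cpair 7 (encode f)
  end.

(** The domain of the program with Gödel number [e]; empty if [e] is not the
    number of a program. *)
Definition W (e x : nat) : Prop :=
  exists c, encode c = e /\ exists y, eval c x y.

Lemma cpair_inj a b a' b' : cpair a b = cpair a' b' -> a = a' /\ b = b'.
Proof.
  intros H. unfold cpair in H. apply Cantor.to_nat_inj in H. now injection H.
Qed.

Lemma encode_inj c d : encode c = encode d -> c = d.
Proof.
  revert d; induction c; intros []; cbn [encode]; intros H;
    apply cpair_inj in H; destruct H as [Ht H]; try discriminate Ht;
    try reflexivity; try (f_equal; now auto);
    apply cpair_inj in H; destruct H; f_equal; auto.
Qed.

Lemma is_ce_iff_W A : is_ce A <-> exists e, set_eq A (W e).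
Proof.
  split.
  - intros [c Hc]. exists (encode c). intros x. rewrite Hc. split.
    + intros Hy. now exists c.
    + intros [d [Hd Hy]]. apply encode_inj in Hd. now subst.
  - intros [e He]. destruct (classic (exists c, encode c = e)) as [[c Hc]|N].
    + exists c. intros x. rewrite (He x). split.
      * intros [d [Hd Hy]]. rewrite <- Hc in Hd. apply encode_inj in Hd.
        now subst.
      * intros Hy. now exists c.
    + exists (Mu Succ). intros x. rewrite (He x). split.
      * intros [d [Hd _]]. destruct N. now exists d.
      * intros [y [Hy _]]. discriminate Hy.
Qed.

(** * Equivalence relations on [nat] under computable reducibility *)

Definition eq_ce (i j : nat) : Prop := set_eq (W i) (W j).

Definition sym_diff (A B : nat -> Prop) (x : nat) : Prop :=
  (A x /\ ~ B x) \/ (B x /\ ~ A x).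

Definition finite_set (A : nat -> Prop) : Prop :=
  exists l : list nat, forall x, A x -> In x l.

Definition E0_ce (i j : nat) : Prop := finite_set (sym_diff (W i) (W j)).

Definition reducible (E F : nat -> nat -> Prop) : Prop :=
  exists f, computable f /\ (forall x y, E x y <-> F (f x) (f y)).

Definition bireducible (E F : nat -> nat -> Prop) : Prop :=
  reducible E F /\ reducible F E.

(** * Computable groups and their actions on c.e. sets *)

(** The underlying set is a computable, possibly finite, subset of [nat];
    [mul] is irrelevant outside it. Computability of inversion follows. *)
Record computable_group := {
  carrier : nat -> Prop;
  mul : nat -> nat -> nat;
  one : nat;
  carrier_computable : computable_set carrier;
  mul_computable : computable2_on (fun x y => carrier x /\ carrier y) mul;
  mul_closed : forall x y, carrier x -> carrier y -> carrier (mul x y);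
  one_closed : carrier one;
  mul_assoc : forall x y z, carrier x -> carrier y -> carrier z ->
    mul x (mul y z) = mul (mul x y) z;
  mul_one_l : forall x, carrier x -> mul one x = x;
  mul_one_r : forall x, carrier x -> mul x one = x;
  mul_inv : forall x, carrier x ->
    exists y, carrier y /\ mul y x = one /\ mul x y = one
}.

(** Left actions on the collection of c.e. sets. Sets being predicates taken
    up to [set_eq], the action has to respect [set_eq]; its values on sets
    that are not c.e. are irrelevant. *)
Record ce_action (G : computable_group) := {
  act : nat -> (nat -> Prop) -> nat -> Prop;
  act_ce : forall g A, carrier G g -> is_ce A -> is_ce (act g A);
  act_ext : forall g A B, carrier G g -> is_ce A -> is_ce B ->
    set_eq A B -> set_eq (act g A) (act g B);
  act_one : forall A, is_ce A -> set_eq (act (one G) A) A;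
  act_mul : forall g h A, carrier G g -> carrier G h -> is_ce A ->
    set_eq (act (mul G g h) A) (act g (act h A))
}.

Arguments act {G} _ _ _ _.

Definition computable_in_indices (G : computable_group) (a : ce_action G)
  : Prop :=
  exists alpha : nat -> nat -> nat,
    computable2_on (fun g _ => carrier G g) alpha /\
    (forall g e, carrier G g -> set_eq (W (alpha g e)) (act a g (W e))).

Definition orbit_rel (G : computable_group) (a : ce_action G) (i j : nat)
  : Prop :=
  exists g, carrier G g /\ set_eq (act a g (W i)) (W j).

Definition ce_orbit_equivalence (E : nat -> nat -> Prop) : Prop :=
  exists (G : computable_group) (a : ce_action G),
    computable_in_indices G a /\ (forall i j, E i j <-> orbit_rel G a i j).

(* Main.v *)
Require Import Defs.
From Stdlib Require Import Arith List Lia Classical Bool ConstructiveEpsilon.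
From Stdlib Require Cantor.
Import ListNotations.

(** An action that is computable in indices is monotone on c.e. sets, since a failure
    of monotonicity would enumerate the complement of the halting set. The group thus acts
    by automorphisms of the lattice of c.e. sets, which permute the singletons, so the
    action is induced by uniformly computable permutations of [nat].

    If these permutations are finitely many, compactness shows that [W_i] is determined
    up to the action by the finite sets some translate of which lies in [W_i]; this reduces
    the orbit relation to [=^ce], and a computable set meeting every orbit at
    most once gives the converse reduction.

    If they are infinitely many, the orbit relation is equivalent to [E_0^ce] because both
    are [Sigma^0_3]. A [Sigma^0_3] equivalence relation can be written as "only finitely many
    permanent cuts separate [i] from [j]" for a computable sequence of cuts of [nat], each of which
    may be discarded at some stage: a cut of [{0..n}] is discarded whenever a [Pi^0_2] witness for a
    relation across it makes progress, and a new copy is then created. Such a form reduces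
    to [E_0^ce] outright (enumerate a cut into every set when it is discarded). To
    reduce it to the orbit relation, the sets [V_i] are kept at each stage in
    the form [u_i D] for one finite set [D], where [u_i] is the product of
    group elements [w_k] over the active cuts [k] having [i] on their left side; discarding a
    cut enlarges [D] until [w_k] and everything after it can be dropped. The [w_k] are chosen so
    that the [k]-th cut, if permanent, diagonalises against the first [k] group elements. *)

(** The two alternatives exclude each other because [=^ce] is [Pi^0_2]: a reduction of [E_0^ce] to
    it is defeated by a self-referential set that grows whenever the equality is confirmed once
    more.

    In the coding, enumerated elements cannot be withdrawn, so inserting or deleting a group element
    may only enlarge each [u_i D]. The [w_k] need not commute, hence a stack: the newest acts on the
    core first, and it alone can be deleted without disturbing the rest. Diagonalising also needs
    points that stay out of [V_i]; each active cut therefore carries a finite set of forbidden core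
    points, which every newer cut must respect.

    Room for a suitable [w_k] comes from infinitude in two ways. If some orbit is infinite, points
    can be moved off any finite set. If all orbits are finite, pointwise stabilisers of finite sets
    have finite index, hence are nontrivial.

    For related [i] and [j], the sets are compared at stages where all active cuts are permanent:
    beyond a fixed bottom part of the stack, [u_i] and [u_j] then have the same factors. *)

Definition pi1 (n : nat) : nat := fst (Cantor.of_nat n).
Definition pi2 (n : nat) : nat := snd (Cantor.of_nat n).

Lemma pi1_cpair x y : pi1 (cpair x y) = x.
Proof. unfold pi1, cpair. now rewrite Cantor.cancel_of_to. Qed.

Lemma pi2_cpair x y : pi2 (cpair x y) = y.
Proof. unfold pi2, cpair. now rewrite Cantor.cancel_of_to. Qed.

Lemma cpair_pi n : cpair (pi1 n) (pi2 n) = n.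
Proof.
  unfold pi1, pi2, cpair. rewrite <- surjective_pairing.
  apply Cantor.cancel_to_of.
Qed.

Lemma cpair_ge x y : x + y <= cpair x y.
Proof. unfold cpair. pose proof (Cantor.to_nat_non_decreasing x y). lia. Qed.

Lemma eval_Fst x : eval Fst x (pi1 x). Proof. reflexivity. Qed.
Lemma eval_Snd x : eval Snd x (pi2 x). Proof. reflexivity. Qed.

Lemma eval_Prec f g x n y :
  eval (Prec f g) (cpair x n) y <->
  nat_rect (fun _ => nat -> Prop) (eval f x)
    (fun k R y => exists r, R r /\ eval g (cpair x (cpair k r)) y) n y.
Proof.
  cbn [eval]. fold (pi1 (cpair x n)). fold (pi2 (cpair x n)).
  now rewrite pi1_cpair, pi2_cpair.
Qed.

Lemma eval_det c : forall x y y', eval c x y -> eval c x y' -> y = y'.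
Proof.
  induction c as [| | | |f IHf g IHg|f IHf g IHg|f IHf g IHg|f IHf];
    intros x y y'; try (cbn; congruence).
  - intros (a & b & Ha & Hb & ->) (a' & b' & Ha' & Hb' & ->).
    f_equal; eauto.
  - intros (z & Hz & Hy) (z' & Hz' & Hy').
    rewrite (IHg _ _ _ Hz' Hz) in Hy'. eauto.
  - rewrite <- (cpair_pi x). generalize (pi1 x) (pi2 x). clear x.
    intros x n. rewrite !eval_Prec. revert y y'.
    induction n as [|n IH]; cbn [nat_rect]; intros y y'; [apply IHf|].
    intros (r & Hr & Hy) (r' & Hr' & Hy').
    rewrite (IH _ _ Hr' Hr) in Hy'. eauto.
  - intros [H0 Hl] [H0' Hl'].
    destruct (lt_eq_lt_dec y y') as [[Hlt|E]|Hlt]; [|exact E|].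
    + destruct (Hl' y Hlt) as [v Hv]. discriminate (IHf _ _ _ H0 Hv).
    + destruct (Hl y' Hlt) as [v Hv]. discriminate (IHf _ _ _ H0' Hv).
Qed.

#[global] Opaque cpair pi1 pi2.

(** * Computable functions between encoded types *)

Class Enc (A : Type) := {
  enc : A -> nat;
  dec : nat -> A;
  dec_enc : forall a, dec (enc a) = a
}.

(** When every number is a code, decoding leaves the underlying number unchanged, so [dec] is
    computed by the identity program. *)
Class SurjEnc (A : Type) `{Enc A} := enc_dec : forall n, enc (dec n) = n.

#[global] Instance enc_nat : Enc nat :=
  { enc := fun n => n; dec := fun n => n; dec_enc := fun n => eq_refl }.

#[global] Instance surj_nat : SurjEnc nat := fun n => eq_refl.

#[global] Program Instance enc_bool : Enc bool :=
  { enc := Nat.b2n; dec := fun n => negb (Nat.eqb n 0) }.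
Next Obligation. now destruct a. Qed.

#[global] Program Instance enc_prod A B `{Enc A} `{Enc B} : Enc (A * B) :=
  { enc := fun p => cpair (enc (fst p)) (enc (snd p));
    dec := fun n => (dec (pi1 n), dec (pi2 n)) }.
Next Obligation. now rewrite pi1_cpair, pi2_cpair, !dec_enc. Qed.

#[global] Instance surj_prod A B `{SurjEnc A} `{SurjEnc B} : SurjEnc (A * B).
Proof. intros n. cbn. now rewrite !enc_dec, cpair_pi. Qed.

Fixpoint enc_seq {A} `{Enc A} (l : list A) : nat :=
  match l with [] => 0 | x :: l => S (cpair (enc x) (enc_seq l)) end.

Fixpoint dec_seq {A} `{Enc A} (fuel n : nat) : list A :=
  match fuel, n with
  | S fuel, S m => dec (pi1 m) :: dec_seq fuel (pi2 m)
  | _, _ => []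
  end.

Lemma dec_enc_seq {A} `{Enc A} (l : list A) :
  forall fuel, enc_seq l <= fuel -> dec_seq fuel (enc_seq l) = l.
Proof.
  induction l as [|x l IH]; intros [|fuel] Hf; cbn in *; try easy.
  pose proof (cpair_ge (enc x) (enc_seq l)).
  rewrite pi1_cpair, pi2_cpair, dec_enc, IH; [easy|lia].
Qed.

#[global] Instance enc_list A `{Enc A} : Enc (list A) :=
  { enc := enc_seq; dec := fun n => dec_seq n n;
    dec_enc := fun l => dec_enc_seq l _ (le_n _) }.

Lemma enc_dec_seq {A} `{SurjEnc A} fuel :
  forall n, n <= fuel -> enc_seq (dec_seq fuel n : list A) = n.
Proof.
  induction fuel as [|fuel IH]; intros [|n] Hn; cbn; try lia.
  pose proof (cpair_ge (pi1 n) (pi2 n)) as Hc. rewrite cpair_pi in Hc.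
  rewrite enc_dec, IH, cpair_pi; lia.
Qed.

#[global] Instance surj_list A `{SurjEnc A} : SurjEnc (list A).
Proof. intros n. now apply enc_dec_seq. Qed.

Definition Computable {A B} `{Enc A} `{Enc B} (f : A -> B) : Prop :=
  exists c, forall a, eval c (enc a) (enc (f a)).

Section Closure.
Context {A B C X : Type} {EA : Enc A} {EB : Enc B} {EC : Enc C} {EX : Enc X}.

Lemma comp_ext (f g : A -> B) :
  (forall a, f a = g a) -> Computable f -> Computable g.
Proof. intros E [c Hc]. exists c. intros a. rewrite <- E. apply Hc. Qed.

Lemma comp_id : Computable (fun a : A => a).
Proof. exists (Pair Fst Snd). intros a. exists (pi1 (enc a)), (pi2 (enc a)).
  rewrite cpair_pi. easy. Qed.

Lemma comp_comp (f : B -> C) (g : A -> B) :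
  Computable f -> Computable g -> Computable (fun a => f (g a)).
Proof.
  intros [cf Hf] [cg Hg]. exists (Comp cf cg). intros a.
  exists (enc (g a)). auto.
Qed.

Lemma comp_pair (f : A -> B) (g : A -> C) :
  Computable f -> Computable g -> Computable (fun a => (f a, g a)).
Proof.
  intros [cf Hf] [cg Hg]. exists (Pair cf cg). intros a.
  exists (enc (f a)), (enc (g a)). auto.
Qed.

Lemma comp_fst (f : A -> B * C) :
  Computable f -> Computable (fun a => fst (f a)).
Proof.
  intros [cf Hf]. exists (Comp Fst cf). intros a. exists (enc (f a)).
  split; [apply Hf|].
  replace (enc (fst (f a))) with (pi1 (enc (f a))) by apply pi1_cpair.
  apply eval_Fst.
Qed.

Lemma comp_snd (f : A -> B * C) :
  Computable f -> Computable (fun a => snd (f a)).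
Proof.
  intros [cf Hf]. exists (Comp Snd cf). intros a. exists (enc (f a)).
  split; [apply Hf|].
  replace (enc (snd (f a))) with (pi2 (enc (f a))) by apply pi2_cpair.
  apply eval_Snd.
Qed.

Lemma comp_S (f : A -> nat) : Computable f -> Computable (fun a => S (f a)).
Proof.
  intros [cf Hf]. exists (Comp Succ cf). intros a. exists (f a).
  split; [apply Hf|reflexivity].
Qed.

Lemma comp_const (b : B) : Computable (fun _ : A => b).
Proof.
  unfold Computable. induction (enc b) as [|n [c Hc]].
  - now exists Zero.
  - exists (Comp Succ c). intros a. exists n. now split.
Qed.

Lemma comp_nat_rect (x0 : A -> X) (F : A -> nat -> X -> X) (n : A -> nat) :
  Computable x0 ->
  Computable (fun q : A * (nat * X) => F (fst q) (fst (snd q)) (snd (snd q))) ->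
  Computable n ->
  Computable (fun a => nat_rect (fun _ => X) (x0 a) (fun k r => F a k r) (n a)).
Proof.
  intros [cx Hx] [cF HF] [cn Hn].
  exists (Comp (Prec cx cF) (Pair (Pair Fst Snd) cn)). intros a.
  exists (cpair (enc a) (n a)). split.
  - exists (enc a), (n a). split; [|split; [apply Hn|reflexivity]].
    exists (pi1 (enc a)), (pi2 (enc a)). now rewrite cpair_pi.
  - apply eval_Prec. induction (n a) as [|k IH]; cbn [nat_rect].
    + apply Hx.
    + eexists. split; [exact IH|].
      exact (HF (a, (k, nat_rect (fun _ => X) (x0 a) (fun k r => F a k r) k))).
Qed.

Lemma comp_enc : Computable (enc : A -> nat).
Proof. exact comp_id. Qed.

Lemma comp_dec {SB : SurjEnc B} (f : A -> nat) :
  Computable f -> Computable (fun a => dec (f a) : B).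
Proof.
  intros [c Hc]. exists c. intros a. rewrite enc_dec. apply Hc.
Qed.

End Closure.

Lemma comp_if {A X} `{Enc A} `{Enc X} (b : A -> bool) (f g : A -> X) :
  Computable b -> Computable f -> Computable g ->
  Computable (fun a => if b a then f a else g a).
Proof.
  intros Hb Hf Hg.
  apply comp_ext with
    (fun a => nat_rect (fun _ => X) (g a) (fun _ _ => f a) (Nat.b2n (b a))).
  - intros a. now destruct (b a).
  - apply (comp_nat_rect g (fun a _ _ => f a)); [easy| |exact Hb].
    apply (comp_comp f (fun q : A * (nat * X) => fst q)); [easy|].
    apply comp_fst, comp_id.
Qed.

Lemma comp_app2 {A B C X} `{Enc A} `{Enc B} `{Enc C} `{Enc X}
    (h : B -> C -> X) (f : A -> B) (g : A -> C) :
  Computable (fun q : B * C => h (fst q) (snd q)) ->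
  Computable f -> Computable g -> Computable (fun a => h (f a) (g a)).
Proof.
  intros Hh Hf Hg.
  exact (comp_comp (fun q => h (fst q) (snd q)) (fun a => (f a, g a)) Hh
           (comp_pair _ _ Hf Hg)).
Qed.

Lemma comp_app3 {A B C D X} `{Enc A} `{Enc B} `{Enc C} `{Enc D} `{Enc X}
    (h : B -> C -> D -> X) (f : A -> B) (g : A -> C) (k : A -> D) :
  Computable (fun q : B * (C * D) => h (fst q) (fst (snd q)) (snd (snd q))) ->
  Computable f -> Computable g -> Computable k ->
  Computable (fun a => h (f a) (g a) (k a)).
Proof.
  intros Hh Hf Hg Hk.
  exact (comp_comp (fun q => h (fst q) (fst (snd q)) (snd (snd q)))
           (fun a => (f a, (g a, k a))) Hh
           (comp_pair _ _ Hf (comp_pair _ _ Hg Hk))).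
Qed.

(** Extension point of [comp], rebound with [::=] as further closure lemmas become available. Goals
    that [comp] cannot treat are left to the user. *)
Ltac comp_hook := fail.

Ltac comp :=
  cbv beta zeta;
  first
    [ assumption
    | apply comp_id
    | apply comp_const
    | lazymatch goal with
      | |- Computable fst => apply (comp_fst (fun a => a)), comp_id
      | |- Computable snd => apply (comp_snd (fun a => a)), comp_id
      | |- Computable (fun a => (_, _)) => apply comp_pair; comp
      | |- Computable (fun a => fst _) => apply comp_fst; comp
      | |- Computable (fun a => snd _) => apply comp_snd; comp
      | |- Computable (fun a => S _) => apply comp_S; comp
      | |- Computable (fun a => if _ then _ else _) => apply comp_if; comp
      | |- Computable (fun a => nat_rect _ _ _ _) => apply comp_nat_rect; comp
      | |- Computable (fun a => enc _) => apply (comp_comp enc); [apply comp_enc|comp]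
      | |- Computable (fun a => dec _) => apply comp_dec; comp
      | |- Computable (fun a => _) => comp_hook
      | |- @Computable ?A ?B ?EA ?EB ?f =>
          tryif is_var f then fail
          else (change (@Computable A B EA EB (fun a => f a)); comp)
      end
    | lazymatch goal with
      | Hc : Computable ?t |- Computable (fun a => ?t _) =>
          apply (comp_comp t _ Hc); comp
      | Hc : Computable (fun q => ?t (fst q) (snd q)) |- Computable (fun a => ?t _ _) =>
          apply (comp_app2 t _ _ Hc); comp
      | Hc : Computable (fun q => ?t (fst q) (fst (snd q)) (snd (snd q)))
        |- Computable (fun a => ?t _ _ _) =>
          apply (comp_app3 t _ _ _ Hc); comp
      end
    | idtac ].

Lemma comp_pred {A} `{Enc A} f : Computable f -> Computable (fun a : A => pred (f a)).
Proof.
  intros Hf. apply comp_ext with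
    (fun a => nat_rect (fun _ => nat) 0 (fun k _ => k) (f a)); [|comp].
  intros a. now destruct (f a).
Qed.

Lemma comp_add {A} `{Enc A} f g :
  Computable f -> Computable g -> Computable (fun a : A => f a + g a).
Proof.
  intros Hf Hg. apply comp_ext with
    (fun a => nat_rect (fun _ => nat) (g a) (fun _ r => S r) (f a)); [|comp].
  intros a. induction (f a); cbn; congruence.
Qed.

Lemma comp_sub {A} `{Enc A} f g :
  Computable f -> Computable g -> Computable (fun a : A => f a - g a).
Proof.
  intros Hf Hg. apply comp_ext with
    (fun a => nat_rect (fun _ => nat) (f a) (fun _ r => pred r) (g a)).
  - intros a. induction (g a) as [|n IH]; cbn; [lia|]. rewrite IH. lia.
  - comp. apply comp_pred. comp.
Qed.

Lemma comp_isz {A} `{Enc A} f :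
  Computable f -> Computable (fun a : A => Nat.eqb (f a) 0).
Proof.
  intros Hf. apply comp_ext with
    (fun a => nat_rect (fun _ => bool) true (fun _ _ => false) (f a)); [|comp].
  intros a. now destruct (f a).
Qed.

Lemma comp_leb {A} `{Enc A} f g :
  Computable f -> Computable g -> Computable (fun a : A => Nat.leb (f a) (g a)).
Proof.
  intros Hf Hg. apply comp_ext with (fun a => Nat.eqb (f a - g a) 0).
  - intros a. destruct (Nat.leb_spec (f a) (g a)).
    + apply Nat.eqb_eq. lia.
    + apply Nat.eqb_neq. lia.
  - now apply comp_isz, comp_sub.
Qed.

Lemma comp_ltb {A} `{Enc A} f g :
  Computable f -> Computable g -> Computable (fun a : A => Nat.ltb (f a) (g a)).
Proof. intros Hf Hg. apply comp_leb; comp. Qed.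

Lemma comp_andb {A} `{Enc A} f g :
  Computable f -> Computable g -> Computable (fun a : A => andb (f a) (g a)).
Proof. intros Hf Hg. apply (comp_if f g (fun _ => false)); comp. Qed.

Lemma comp_orb {A} `{Enc A} f g :
  Computable f -> Computable g -> Computable (fun a : A => orb (f a) (g a)).
Proof. intros Hf Hg. apply (comp_if f (fun _ => true) g); comp. Qed.

Lemma comp_negb {A} `{Enc A} f :
  Computable f -> Computable (fun a : A => negb (f a)).
Proof. intros Hf. apply (comp_if f (fun _ => false) (fun _ => true)); comp. Qed.

Lemma comp_eqb {A} `{Enc A} f g :
  Computable f -> Computable g -> Computable (fun a : A => Nat.eqb (f a) (g a)).
Proof.
  intros Hf Hg. apply comp_ext with (fun a => Nat.leb (f a) (g a) && Nat.leb (g a) (f a)).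
  - intros a. destruct (Nat.eqb_spec (f a) (g a)) as [->|N].
    + now rewrite Nat.leb_refl.
    + apply andb_false_iff. rewrite !Nat.leb_gt. lia.
  - now apply comp_andb; apply comp_leb.
Qed.

Lemma comp_beqb {A} `{Enc A} f g :
  Computable f -> Computable g -> Computable (fun a : A => Bool.eqb (f a) (g a)).
Proof.
  intros Hf Hg. apply comp_ext with (fun a => if f a then g a else negb (g a)).
  - intros a. now destruct (f a), (g a).
  - apply comp_if; [| |apply comp_negb]; comp.
Qed.

Lemma comp_max {A} `{Enc A} f g :
  Computable f -> Computable g -> Computable (fun a : A => Nat.max (f a) (g a)).
Proof.
  intros Hf Hg. apply comp_ext with (fun a => f a + (g a - f a)).
  - intros a. lia.
  - now apply comp_add, comp_sub.
Qed.

Lemma comp_cpair {A} `{Enc A} f g :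
  Computable f -> Computable g -> Computable (fun a : A => cpair (f a) (g a)).
Proof. intros Hf Hg. exact (comp_pair f g Hf Hg). Qed.

Lemma comp_pi1 {A} `{Enc A} f : Computable f -> Computable (fun a : A => pi1 (f a)).
Proof.
  intros Hf. apply (comp_comp pi1 f); [|easy]. exists Fst. intros a. apply eval_Fst.
Qed.

Lemma comp_pi2 {A} `{Enc A} f : Computable f -> Computable (fun a : A => pi2 (f a)).
Proof.
  intros Hf. apply (comp_comp pi2 f); [|easy]. exists Snd. intros a. apply eval_Snd.
Qed.

Ltac comp_hook1 :=
  lazymatch goal with
  | |- Computable (fun a => pred _) => apply comp_pred; comp
  | |- Computable (fun a => _ + _) => apply comp_add; comp
  | |- Computable (fun a => _ - _) => apply comp_sub; comp
  | |- Computable (fun a => Nat.eqb _ _) => apply comp_eqb; comp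
  | |- Computable (fun a => Nat.leb _ _) => apply comp_leb; comp
  | |- Computable (fun a => Nat.ltb _ _) => apply comp_ltb; comp
  | |- Computable (fun a => andb _ _) => apply comp_andb; comp
  | |- Computable (fun a => orb _ _) => apply comp_orb; comp
  | |- Computable (fun a => negb _) => apply comp_negb; comp
  | |- Computable (fun a => Bool.eqb _ _) => apply comp_beqb; comp
  | |- Computable (fun a => Nat.max _ _) => apply comp_max; comp
  | |- Computable (fun a => cpair _ _) => apply comp_cpair; comp
  | |- Computable (fun a => pi1 _) => apply comp_pi1; comp
  | |- Computable (fun a => pi2 _) => apply comp_pi2; comp
  end.
Ltac comp_hook ::= comp_hook1.

(** * Bounded quantifiers and lists *)

Definition all_lt (n : nat) (P : nat -> bool) : bool :=
  nat_rect (fun _ => bool) true (fun k r => andb r (P k)) n.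

Definition ex_lt (n : nat) (P : nat -> bool) : bool :=
  nat_rect (fun _ => bool) false (fun k r => orb r (P k)) n.

Lemma all_ltP n P : all_lt n P = true <-> forall k, k < n -> P k = true.
Proof.
  induction n as [|n IH]; cbn; [easy + (split; [intros; lia|easy])|].
  fold (all_lt n P). rewrite andb_true_iff, IH. split.
  - intros [Hl Hn] k Hk. destruct (Nat.eq_dec k n) as [->|]; [easy|].
    apply Hl. lia.
  - intros Hk. split; [intros|]; apply Hk; lia.
Qed.

Lemma ex_ltP n P : ex_lt n P = true <-> exists k, k < n /\ P k = true.
Proof.
  induction n as [|n IH]; cbn; [split; [easy|now intros (k & Hk & _)]|].
  fold (ex_lt n P). rewrite orb_true_iff, IH. split.
  - intros [(k & Hk & HP)|HP]; [exists k|exists n]; split; trivial; lia.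
  - intros (k & Hk & HP). destruct (Nat.eq_dec k n) as [->|]; [now right|].
    left. exists k. split; trivial; lia.
Qed.

Lemma comp_all_lt {A} `{Enc A} n (P : A -> nat -> bool) :
  Computable n -> Computable (fun q : A * nat => P (fst q) (snd q)) ->
  Computable (fun a : A => all_lt (n a) (P a)).
Proof.
  intros Hn HP. apply comp_nat_rect; comp.
Qed.

Lemma comp_ex_lt {A} `{Enc A} n (P : A -> nat -> bool) :
  Computable n -> Computable (fun q : A * nat => P (fst q) (snd q)) ->
  Computable (fun a : A => ex_lt (n a) (P a)).
Proof.
  intros Hn HP. apply comp_nat_rect; comp.
Qed.

Definition is_nil {X} (l : list X) : bool :=
  match l with [] => true | _ => false end.

Section Lists.
Context {A X : Type} {EA : Enc A} {EX : Enc X}.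

Lemma comp_is_nil (f : A -> list X) :
  Computable f -> Computable (fun a => is_nil (f a)).
Proof.
  intros Hf. apply comp_ext with (fun a => Nat.eqb (enc (f a)) 0); [|comp].
  intros a. now destruct (f a).
Qed.

Lemma comp_cons (f : A -> X) (g : A -> list X) :
  Computable f -> Computable g -> Computable (fun a => f a :: g a).
Proof.
  intros Hf Hg.
  assert (Hc : Computable (fun a => S (cpair (enc (f a)) (enc (g a))))) by comp.
  exact Hc.
Qed.

Lemma comp_hd (d : X) (f : A -> list X) :
  Computable f -> Computable (fun a => hd d (f a)).
Proof.
  intros Hf.
  assert (Hc : Computable (fun a => if is_nil (f a) then enc d else pi1 (pred (enc (f a))))).
  { comp. now apply comp_is_nil. }
  destruct Hc as [c Hc]. exists c. intros a. generalize (Hc a).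
  destruct (f a); cbn; [easy|]. now rewrite pi1_cpair.
Qed.

Lemma comp_tl (f : A -> list X) :
  Computable f -> Computable (fun a => tl (f a)).
Proof.
  intros Hf.
  assert (Hc : Computable (fun a => if is_nil (f a) then 0 else pi2 (pred (enc (f a))))).
  { comp. now apply comp_is_nil. }
  destruct Hc as [c Hc]. exists c. intros a. generalize (Hc a).
  destruct (f a); cbn; [easy|]. now rewrite pi2_cpair.
Qed.

Lemma enc_list_length (l : list X) : length l <= enc l.
Proof.
  induction l as [|x l IH]; cbn in *; [lia|].
  pose proof (cpair_ge (enc x) (enc_seq l)). lia.
Qed.

End Lists.

Lemma comp_fold_left {A X Y} `{Enc A} `{Enc X} `{Enc Y} (F : A -> Y -> X -> Y) (l : A -> list X) (y0 : A -> Y) :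
  Computable (fun q : A * (Y * X) => F (fst q) (fst (snd q)) (snd (snd q))) ->
  Computable l -> Computable y0 ->
  Computable (fun a => fold_left (F a) (l a) (y0 a)).
Proof.
  intros HF Hl Hy.
  set (step a (st : Y * list X) := if is_nil (snd st) then st
     else (F a (fst st) (hd (dec 0) (snd st)), tl (snd st))).
  (* The code of a list bounds its length, so that many steps consume it; surplus steps idle on the
     empty list. *)
  apply comp_ext with (fun a => fst (nat_rect (fun _ => (Y * list X)%type)
    (y0 a, l a) (fun _ st => step a st) (enc (l a)))).
  - intros a.
    assert (HI : forall n l y, length l <= n ->
      nat_rect (fun _ => (Y * list X)%type) (y, l) (fun _ st => step a st) n
      = (fold_left (F a) l y, [])).
    { assert (Hs : forall n st, nat_rect (fun _ => (Y * list X)%type) st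
        (fun _ st => step a st) (S n) = nat_rect (fun _ => (Y * list X)%type)
        (step a st) (fun _ st => step a st) n).
      { intros n st. induction n as [|n IH]; [easy|]. cbn in *. now rewrite IH. }
      induction n as [|n IH]; intros l' y Hn.
      - destruct l'; [easy|]. cbn in Hn. lia.
      - rewrite Hs. destruct l' as [|x l']; cbn in Hn |- *.
        + apply IH. cbn. lia.
        + apply IH. lia. }
    rewrite HI; [easy|]. apply enc_list_length.
  - comp. unfold step. comp.
    + apply comp_is_nil. comp.
    + apply comp_hd. comp.
    + apply comp_tl. comp.
Qed.

Lemma comp_rev {A X} `{Enc A} `{Enc X} (l : A -> list X) : Computable l -> Computable (fun a => rev (l a)).
Proof.
  intros Hl. apply comp_ext with
    (fun a => fold_left (fun acc x => x :: acc) (l a) []).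
  - intros a. rewrite <- (app_nil_r (rev _)). generalize (@nil X).
    induction (l a) as [|x l' IH]; intros acc; cbn; [easy|].
    now rewrite IH, <- app_assoc.
  - apply comp_fold_left; comp. apply comp_cons; comp.
Qed.

Section Lists2.
Context {A X Y : Type} {EA : Enc A} {EX : Enc X} {EY : Enc Y}.

Lemma comp_map (f : A -> X -> Y) (l : A -> list X) :
  Computable (fun q : A * X => f (fst q) (snd q)) -> Computable l ->
  Computable (fun a => map (f a) (l a)).
Proof.
  intros Hf Hl. apply comp_ext with
    (fun a => rev (fold_left (fun acc x => f a x :: acc) (l a) [])).
  - intros a.
    enough (E : forall l acc, rev (fold_left (fun acc x => f a x :: acc) l acc)
        = rev acc ++ map (f a) l) by apply (E _ []).
    intros l'. induction l' as [|x l' IH]; intros acc; cbn.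
    + now rewrite app_nil_r.
    + rewrite IH. cbn. now rewrite <- app_assoc.
  - apply comp_rev. apply (comp_fold_left (fun a acc x => f a x :: acc)); comp.
    apply comp_cons; comp.
Qed.

Lemma comp_app (f g : A -> list X) :
  Computable f -> Computable g -> Computable (fun a => f a ++ g a).
Proof.
  intros Hf Hg. apply comp_ext with
    (fun a => fold_left (fun acc x => x :: acc) (rev (f a)) (g a)).
  - intros a. rewrite <- (rev_involutive (f a)) at 2. generalize (g a).
    induction (rev (f a)) as [|x l IH]; intros acc; cbn; [easy|].
    now rewrite IH, <- app_assoc.
  - apply comp_fold_left; comp.
    + apply comp_cons; comp.
    + now apply comp_rev.
Qed.

End Lists2.

Lemma comp_existsb {A X} `{Enc A} `{Enc X} (P : A -> X -> bool) (l : A -> list X) :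
  Computable (fun q : A * X => P (fst q) (snd q)) -> Computable l ->
  Computable (fun a => existsb (P a) (l a)).
Proof.
  intros HP Hl. apply comp_ext with
    (fun a => fold_left (fun acc x => orb acc (P a x)) (l a) false).
  - intros a. change (existsb (P a) (l a)) with (orb false (existsb (P a) (l a))).
    generalize false. induction (l a) as [|x l' IH]; intros b; cbn.
    + now rewrite orb_false_r.
    + now rewrite IH, orb_assoc.
  - apply (comp_fold_left (fun a acc x => orb acc (P a x))); comp.
Qed.

Lemma comp_forallb {A X} `{Enc A} `{Enc X} (P : A -> X -> bool) (l : A -> list X) :
  Computable (fun q : A * X => P (fst q) (snd q)) -> Computable l ->
  Computable (fun a => forallb (P a) (l a)).
Proof.
  intros HP Hl. apply comp_ext with
    (fun a => negb (existsb (fun x => negb (P a x)) (l a))).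
  - intros a. induction (l a) as [|x l' IH]; cbn; [easy|].
    rewrite negb_orb, negb_involutive. now rewrite IH.
  - comp. apply (comp_existsb (fun a x => negb (P a x))); comp.
Qed.

Ltac comp_hook2 :=
  lazymatch goal with
  | |- Computable (fun a => all_lt _ _) => apply comp_all_lt; comp
  | |- Computable (fun a => ex_lt _ _) => apply comp_ex_lt; comp
  | |- Computable (fun a => is_nil _) => apply comp_is_nil; comp
  | |- Computable (fun a => _ :: _) => apply comp_cons; comp
  | |- Computable (fun a => hd _ _) => apply comp_hd; comp
  | |- Computable (fun a => tl _) => apply comp_tl; comp
  | |- Computable (fun a => fold_left _ _ _) => apply comp_fold_left; comp
  | |- Computable (fun a => map _ _) => apply comp_map; comp
  | |- Computable (fun a => _ ++ _) => apply comp_app; comp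
  | |- Computable (fun a => existsb _ _) => apply comp_existsb; comp
  | |- Computable (fun a => forallb _ _) => apply comp_forallb; comp
  | |- _ => comp_hook1
  end.
Ltac comp_hook ::= comp_hook2.

(** * A universal machine *)

Lemma nat_iter_S {X} (f : X -> X) n x : Nat.iter (S n) f x = Nat.iter n f (f x).
Proof. induction n as [|n IH]; [easy|]. cbn in *. now rewrite IH. Qed.

Lemma nat_iter_add {X} (f : X -> X) m n x :
  Nat.iter (m + n) f x = Nat.iter n f (Nat.iter m f x).
Proof.
  revert x. induction m as [|m IH]; intros x; [easy|].
  cbn [plus]. now rewrite !nat_iter_S, IH.
Qed.

Lemma comp_iter {A X} `{Enc A} `{Enc X} (f : X -> X) (n : A -> nat) (x : A -> X) :
  Computable f -> Computable n -> Computable x ->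
  Computable (fun a => Nat.iter (n a) f (x a)).
Proof.
  intros Hf Hn Hx. apply (comp_nat_rect x (fun _ _ r => f r) n); comp.
Qed.

(** A frame is [(tag, (c, (x, (k, n))))]; tag [0] runs program [c] on the
    current value, tags [1] to [4] resume [Pair], [Pair], [Prec] and [Mu]. *)
Definition frame : Type := (nat * (nat * (nat * (nat * nat))))%type.
Definition mstate : Type := (list frame * nat)%type.

Definition run_frame (c : nat) : frame := (0, (c, (0, (0, 0)))).

Definition start_frame (c : nat) (r : list frame) (v : nat) : mstate :=
  let t := pi1 c in
  let d := pi2 c in
  let f := pi1 d in
  let g := pi2 d in
  if Nat.eqb t 0 then (r, 0)
  else if Nat.eqb t 1 then (r, S v)
  else if Nat.eqb t 2 then (r, pi1 v)
  else if Nat.eqb t 3 then (r, pi2 v)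
  else if Nat.eqb t 4 then (run_frame f :: (1, (g, (v, (0, 0)))) :: r, v)
  else if Nat.eqb t 5 then (run_frame g :: run_frame f :: r, v)
  else if Nat.eqb t 6 then
    (run_frame f :: (3, (g, (pi1 v, (0, pi2 v)))) :: r, pi1 v)
  else (run_frame d :: (4, (d, (v, (0, 0)))) :: r, cpair v 0).

Definition resume_frame (fr : frame) (r : list frame) (v : nat) : mstate :=
  let t := fst fr in
  let c := fst (snd fr) in
  let x := fst (snd (snd fr)) in
  let k := fst (snd (snd (snd fr))) in
  let n := snd (snd (snd (snd fr))) in
  if Nat.eqb t 0 then start_frame c r v
  else if Nat.eqb t 1 then (run_frame c :: (2, (v, (0, (0, 0)))) :: r, x)
  else if Nat.eqb t 2 then (r, cpair c v)
  else if Nat.eqb t 3 then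
    if Nat.eqb k n then (r, v)
    else (run_frame c :: (3, (c, (x, (S k, n)))) :: r, cpair x (cpair k v))
  else
    if Nat.eqb v 0 then (r, k)
    else (run_frame c :: (4, (c, (x, (S k, 0)))) :: r, cpair x (S k)).

Definition mstep (st : mstate) : mstate :=
  if is_nil (fst st) then st
  else resume_frame (hd (run_frame 0) (fst st)) (tl (fst st)) (snd st).

Lemma comp_mstep : Computable mstep.
Proof.
  assert (Hs : Computable (fun q : nat * (list frame * nat) =>
    start_frame (fst q) (fst (snd q)) (snd (snd q)))).
  { unfold start_frame, run_frame. comp. }
  assert (Hr : Computable (fun q : frame * (list frame * nat) =>
    resume_frame (fst q) (fst (snd q)) (snd (snd q)))).
  { unfold resume_frame, run_frame. comp. }
  unfold mstep. comp.
Qed.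

Definition reaches (n : nat) (s t : mstate) : Prop := Nat.iter n mstep s = t.

Lemma reaches_S n fr r v t :
  reaches (S n) (fr :: r, v) t <-> reaches n (resume_frame fr r v) t.
Proof. unfold reaches. now rewrite nat_iter_S. Qed.

Lemma reaches_trans m n s t u : reaches m s t -> reaches n t u -> reaches (m + n) s u.
Proof. unfold reaches. intros <- <-. apply nat_iter_add. Qed.

Lemma run_complete c : forall x y r, eval c x y ->
  exists n, reaches n (run_frame (encode c) :: r, x) (r, y).
Proof.
  induction c as [| | | |f IHf g IHg|f IHf g IHg|f IHf g IHg|f IHf];
    intros x y r Hc.
  1-4: exists 1; apply reaches_S; cbn in Hc; subst y; cbn [resume_frame run_frame fst snd Nat.eqb];
    unfold start_frame; cbn [encode]; rewrite pi1_cpair; reflexivity.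
  - destruct Hc as (a & b & Ha & Hb & ->).
    destruct (IHf x a ((1, (encode g, (x, (0, 0)))) :: r) Ha) as [n Hn].
    destruct (IHg x b ((2, (a, (0, (0, 0)))) :: r) Hb) as [m Hm].
    exists (S (n + S (m + 1))). apply reaches_S.
    unfold resume_frame, start_frame; cbn [encode run_frame fst snd Nat.eqb].
    rewrite pi1_cpair, pi2_cpair, pi1_cpair, pi2_cpair.
    eapply reaches_trans; [exact Hn|]. apply reaches_S.
    eapply reaches_trans; [exact Hm|]. now apply reaches_S.
  - destruct Hc as (z & Hz & Hy).
    destruct (IHg x z (run_frame (encode f) :: r) Hz) as [n Hn].
    destruct (IHf z y r Hy) as [m Hm].
    exists (S (n + m)). apply reaches_S.
    unfold resume_frame, start_frame; cbn [encode run_frame fst snd Nat.eqb].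
    rewrite pi1_cpair, pi2_cpair, pi1_cpair, pi2_cpair.
    eapply reaches_trans; [exact Hn|exact Hm].
  - rewrite <- (cpair_pi x) in Hc. apply (proj1 (eval_Prec _ _ _ _ _)) in Hc.
    remember (pi1 x) as a eqn:Ea. remember (pi2 x) as m eqn:Em.
    enough (HP : forall k, k <= m -> exists z n,
       nat_rect (fun _ => nat -> Prop) (eval f a)
        (fun k R y => exists r, R r /\ eval g (cpair a (cpair k r)) y) k z /\
       reaches n (run_frame (cpair 6 (cpair (encode f) (encode g))) :: r, x)
         ((3, (encode g, (a, (k, m)))) :: r, z)).
    { destruct (HP m (le_n _)) as (z & n & Hz & Hn).
      assert (z = y) as ->.
      { apply (eval_det (Prec f g) (cpair a m)); apply (proj2 (eval_Prec _ _ _ _ _)); assumption. }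
      exists (n + 1). eapply reaches_trans; [exact Hn|]. apply reaches_S.
      unfold resume_frame; cbn [fst snd Nat.eqb]. now rewrite Nat.eqb_refl. }
    (* Convergence of the recursion at [m] forces convergence at every earlier index, by descent
       from [m]. *)
    assert (Hex : forall k, k <= m -> exists z, nat_rect (fun _ => nat -> Prop) (eval f a)
        (fun k R y => exists r, R r /\ eval g (cpair a (cpair k r)) y) k z).
    { intros k Hk. replace k with (m - (m - k)) by lia.
      generalize (m - k). intros d. induction d as [|d [z IH]].
      - exists y. now rewrite Nat.sub_0_r.
      - destruct (m - d) as [|l] eqn:El.
        + exists z. now replace (m - S d) with 0 by lia.
        + replace (m - S d) with l by lia. destruct IH as (z' & Hz' & _). now exists z'. }
    induction k as [|k IH]; intros Hk.
    + destruct (Hex 0 Hk) as [z Hz].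
      destruct (IHf a z ((3, (encode g, (a, (0, m)))) :: r) Hz) as [n Hn].
      exists z, (S n). split; [exact Hz|]. apply reaches_S.
      unfold resume_frame, start_frame; cbn [run_frame fst snd Nat.eqb].
      rewrite pi1_cpair, pi2_cpair, pi1_cpair, pi2_cpair, <- Ea, <- Em. exact Hn.
    + destruct (Hex (S k) Hk) as (z & z0 & Hz0 & Hz).
      destruct IH as (z' & n & Hz' & Hn); [lia|].
      assert (z' = z0) as ->.
      { apply (eval_det (Prec f g) (cpair a k)); apply (proj2 (eval_Prec _ _ _ _ _)); assumption. }
      destruct (IHg _ _ ((3, (encode g, (a, (S k, m)))) :: r) Hz) as [n' Hn'].
      exists z, (n + S n'). split; [now exists z0|].
      eapply reaches_trans; [exact Hn|]. apply reaches_S.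
      unfold resume_frame; cbn [fst snd Nat.eqb].
      rewrite (proj2 (Nat.eqb_neq k m)) by lia. exact Hn'.
  - destruct Hc as [H0 Hl].
    enough (HP : forall k, k <= y -> exists n,
       reaches n (run_frame (cpair 7 (encode f)) :: r, x)
         (run_frame (encode f) :: (4, (encode f, (x, (k, 0)))) :: r, cpair x k)).
    { destruct (HP y (le_n _)) as (n & Hn).
      destruct (IHf _ _ ((4, (encode f, (x, (y, 0)))) :: r) H0) as [m Hm].
      exists (n + (m + 1)). eapply reaches_trans; [exact Hn|].
      eapply reaches_trans; [exact Hm|]. now apply reaches_S. }
    induction k as [|k IH]; intros Hk.
    + exists 1. apply reaches_S.
      unfold resume_frame, start_frame; cbn [run_frame fst snd Nat.eqb].
      rewrite pi1_cpair, pi2_cpair. reflexivity.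
    + destruct IH as (n & Hn); [lia|]. destruct (Hl k) as [v Hv]; [lia|].
      destruct (IHf _ _ ((4, (encode f, (x, (k, 0)))) :: r) Hv) as [m Hm].
      exists (n + (m + 1)). eapply reaches_trans; [exact Hn|].
      eapply reaches_trans; [exact Hm|]. now apply reaches_S.
Qed.

(** The stack empties in the end, so every frame that is started must return. The loops of [Prec]
    and [Mu] have no structural bound and need an inner induction on the number of remaining machine
    steps. *)
Lemma run_sound c : forall n x r w,
  reaches n (run_frame (encode c) :: r, x) ([], w) ->
  exists y m, m < n /\ eval c x y /\ reaches m (r, y) ([], w).
Proof.
  induction c as [| | | |f IHf g IHg|f IHf g IHg|f IHf g IHg|f IHf];
    intros [|n] x r w Hn; try discriminate Hn; apply reaches_S in Hn;
    unfold resume_frame, start_frame in Hn; cbn [encode run_frame fst snd Nat.eqb] in Hn;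
    rewrite pi1_cpair, ?pi2_cpair in Hn; cbn [Nat.eqb] in Hn;
    rewrite ?pi1_cpair, ?pi2_cpair in Hn.
  1-4: eexists _, n; split; [lia|]; split; [reflexivity|exact Hn].
  - apply IHf in Hn as (a & m & Hm & Ha & Hr). destruct m as [|m]; [discriminate Hr|].
    apply reaches_S in Hr. apply IHg in Hr as (b & m' & Hm' & Hb & Hr).
    destruct m' as [|m']; [discriminate Hr|]. apply reaches_S in Hr.
    exists (cpair a b), m'. split; [lia|]. split; [now exists a, b|exact Hr].
  - apply IHg in Hn as (z & m & Hm & Hz & Hr).
    apply IHf in Hr as (y & m' & Hm' & Hy & Hr).
    exists y, m'. split; [lia|]. split; [now exists z|exact Hr].
  - enough (HP : forall m, forall k z,
      reaches m ((3, (encode g, (pi1 x, (k, pi2 x)))) :: r, z) ([], w) ->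
      nat_rect (fun _ => nat -> Prop) (eval f (pi1 x))
        (fun k R y => exists r, R r /\ eval g (cpair (pi1 x) (cpair k r)) y) k z ->
      exists y m', m' < m /\ eval (Prec f g) x y /\ reaches m' (r, y) ([], w)).
    { apply IHf in Hn as (z & m & Hm & Hz & Hr).
      destruct (HP m 0 z Hr Hz) as (y & m' & Hm' & Hy & Hr').
      exists y, m'. split; [lia|now split]. }
    induction m as [m IH] using (well_founded_induction lt_wf). intros k z Hm Hz.
    destruct m as [|m]; [discriminate Hm|]. apply reaches_S in Hm.
    unfold resume_frame in Hm; cbn [fst snd Nat.eqb] in Hm.
    destruct (Nat.eqb_spec k (pi2 x)) as [->|Hk].
    + exists z, m. split; [lia|]. split; [|exact Hm].
      rewrite <- (cpair_pi x). now apply (proj2 (eval_Prec _ _ _ _ _)).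
    + apply IHg in Hm as (z' & m' & Hm' & Hz' & Hr).
      destruct (IH m' ltac:(lia) (S k) z' Hr) as (y & m2 & Hm2 & Hy & Hr2).
      { now exists z. }
      exists y, m2. split; [lia|now split].
  - enough (HP : forall m, forall k,
      reaches m (run_frame (encode f) :: (4, (encode f, (x, (k, 0)))) :: r, cpair x k) ([], w) ->
      (forall z, z < k -> exists v, eval f (cpair x z) (S v)) ->
      exists y m', m' < m /\ eval (Mu f) x y /\ reaches m' (r, y) ([], w)).
    { destruct (HP n 0 Hn ltac:(intros; lia)) as (y & m' & Hm' & Hy).
      exists y, m'. split; [lia|exact Hy]. }
    induction m as [m IH] using (well_founded_induction lt_wf). intros k Hm Hk.
    apply IHf in Hm as (v & m' & Hm' & Hv & Hr). destruct m' as [|m']; [discriminate Hr|].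
    apply reaches_S in Hr. unfold resume_frame in Hr; cbn [fst snd Nat.eqb] in Hr.
    destruct v as [|v]; cbn [Nat.eqb] in Hr.
    + exists k, m'. split; [lia|]. split; [|exact Hr]. now split.
    + destruct (IH m' ltac:(lia) (S k) Hr) as (y & m2 & Hm2 & Hy).
      { intros z Hz. destruct (Nat.eq_dec z k) as [->|]; [now exists v|]. apply Hk. lia. }
      exists y, m2. split; [lia|exact Hy].
Qed.

(** Gödel numbers are recognised by a worklist of numbers still to be checked. *)
Definition chk_step (l : list nat) : list nat :=
  if is_nil l then [] else
  let t := pi1 (hd 0 l) in
  let d := pi2 (hd 0 l) in
  if Nat.ltb t 4 then if Nat.eqb d 0 then tl l else l
  else if Nat.ltb t 7 then pi1 d :: pi2 d :: tl l
  else if Nat.eqb t 7 then d :: tl l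
  else l.

Lemma comp_chk_step : Computable chk_step.
Proof. unfold chk_step. comp. Qed.

Lemma chk_complete c : forall r, exists n, Nat.iter n chk_step (encode c :: r) = r.
Proof.
  induction c as [| | | |f IHf g IHg|f IHf g IHg|f IHf g IHg|f IHf]; intros r.
  1-4: exists 1; cbn [Nat.iter nat_rect]; unfold chk_step; cbn [encode hd is_nil tl];
    rewrite pi1_cpair, pi2_cpair; reflexivity.
  4: { destruct (IHf r) as [n Hn]. exists (S n). rewrite nat_iter_S.
       unfold chk_step at 2; cbn [encode hd is_nil tl].
       rewrite pi1_cpair, pi2_cpair. exact Hn. }
  all: destruct (IHf (encode g :: r)) as [n Hn]; destruct (IHg r) as [m Hm];
    exists (S (n + m)); rewrite nat_iter_S; unfold chk_step at 2; cbn [encode hd is_nil tl];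
    rewrite pi1_cpair, pi2_cpair, pi1_cpair, pi2_cpair; cbn [Nat.ltb Nat.leb];
    rewrite nat_iter_add, Hn; exact Hm.
Qed.

Lemma iter_fix {X} (f : X -> X) x n : f x = x -> Nat.iter n f x = x.
Proof. intros E. induction n as [|n IH]; [easy|]. now rewrite nat_iter_S, E. Qed.

(** A number with an illegal tag or argument is a fixed point of [chk_step], so the worklist would
    never empty. *)
Lemma chk_sound n : forall e r, Nat.iter n chk_step (e :: r) = [] ->
  exists c m, m < n /\ encode c = e /\ Nat.iter m chk_step r = [].
Proof.
  induction n as [n IH] using (well_founded_induction lt_wf). intros e r Hn.
  destruct n as [|n]; [discriminate Hn|]. rewrite nat_iter_S in Hn.
  assert (Hstuck : chk_step (e :: r) = e :: r -> False).
  { intros E. rewrite E, iter_fix in Hn by exact E. discriminate Hn. }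
  unfold chk_step in Hn at 2. unfold chk_step in Hstuck. cbn [is_nil hd tl] in Hn, Hstuck.
  rewrite <- (cpair_pi e). destruct (pi1 e) as [|[|[|[|[|[|[|[|t]]]]]]]];
    cbn [Nat.ltb Nat.leb Nat.eqb] in Hn, Hstuck.
  9: now destruct Hstuck.
  1-4: destruct (Nat.eqb_spec (pi2 e) 0) as [->|]; [|now destruct Hstuck].
  1: exists Zero, n. 2: exists Succ, n. 3: exists Fst, n. 4: exists Snd, n.
  1-4: now repeat split; try lia.
  4: { apply IH in Hn as (c & m & Hm & <- & Hr); [|lia].
       exists (Mu c), m. split; [lia|now split]. }
  all: apply IH in Hn as (c & m & Hm & Ec & Hr); [|lia];
    apply IH in Hr as (d & m' & Hm' & Ed & Hr); [|lia];
    rewrite <- (cpair_pi (pi2 e)), <- Ec, <- Ed.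
  1: exists (Pair c d), m'. 2: exists (Comp c d), m'. 3: exists (Prec c d), m'.
  all: split; [lia|now split].
Qed.

(** Stage [s] of the enumeration of [W e]. The first conjunct rejects numbers that encode no
    program, on which the interpreter would run all the same. Both iterations are stationary once
    their list is empty, whence monotonicity in [s]. *)
Definition Wst (e x s : nat) : bool :=
  is_nil (Nat.iter s chk_step [e]) && is_nil (fst (Nat.iter s mstep ([run_frame e], x))).

Lemma comp_Wst {A} `{Enc A} (f g h : A -> nat) :
  Computable f -> Computable g -> Computable h ->
  Computable (fun a => Wst (f a) (g a) (h a)).
Proof.
  intros Hf Hg Hh. unfold Wst, run_frame. comp.
  - apply comp_iter; comp. apply comp_chk_step.
  - apply comp_iter; comp. apply comp_mstep.
Qed.

Lemma Wst_mono e x s t : s <= t -> Wst e x s = true -> Wst e x t = true.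
Proof.
  intros Hst. unfold Wst. rewrite !andb_true_iff. replace t with (s + (t - s)) by lia.
  rewrite !nat_iter_add. intros [H1 H2]. split.
  - destruct (Nat.iter s chk_step [e]); [|discriminate H1]. now rewrite iter_fix.
  - destruct (Nat.iter s mstep _) as [[|] v]; [|discriminate H2]. now rewrite iter_fix.
Qed.

Lemma W_Wst e x : W e x <-> exists s, Wst e x s = true.
Proof.
  split.
  - intros (c & <- & y & Hy).
    destruct (run_complete c x y [] Hy) as [n Hn].
    destruct (chk_complete c []) as [m Hm]. exists (n + m).
    unfold Wst. apply andb_true_iff. split.
    + now rewrite Nat.add_comm, nat_iter_add, Hm, iter_fix.
    + unfold reaches in Hn. now rewrite nat_iter_add, Hn, iter_fix.
  - intros [s Hs]. apply andb_true_iff in Hs as [H1 H2].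
    destruct (Nat.iter s chk_step [e]) eqn:E1; [|discriminate H1].
    destruct (Nat.iter s mstep _) as [[|] v] eqn:E2; [|discriminate H2].
    apply chk_sound in E1 as (c & m & _ & <- & _).
    apply run_sound in E2 as (y & _ & _ & Hy & _). exists c. split; [easy|now exists y].
Qed.

(** * Uniformly c.e. families and the fixed-point theorem *)

Lemma Computable_computable (f : nat -> nat) : Computable f <-> computable f.
Proof. split; intros [c Hc]; exists c; intros x; [intros _|]; now apply Hc. Qed.

Lemma least_true (P : nat -> bool) s :
  P s = true -> exists m, P m = true /\ forall k, k < m -> P k = false.
Proof.
  induction s as [s IH] using (well_founded_induction lt_wf). intros Hs.
  destruct (classic (exists k, k < s /\ P k = true)) as [(k & Hk & HP)|N].
  - now apply (IH k).
  - exists s. split; [easy|]. intros k Hk. apply not_true_is_false.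
    intros HP. apply N. now exists k.
Qed.

Lemma comp_search {A} `{Enc A} (P : A -> nat -> bool) :
  Computable (fun q : A * nat => P (fst q) (snd q)) ->
  (forall a, exists n, P a n = true) ->
  exists f : A -> nat, Computable f /\ forall a, P a (f a) = true.
Proof.
  intros HP Hex.
  (* Minimality makes the witness the very value that [Mu] returns; uniqueness and decidability let
     it be extracted from a mere existence proof. *)
  assert (Hl : forall a, { m | P a m = true /\ forall k, k < m -> P a k = false }).
  { intros a. apply constructive_indefinite_ground_description_nat.
    - intros n.
      destruct (P a n && negb (ex_lt n (P a))) eqn:E;
        rewrite ?andb_true_iff, ?andb_false_iff, ?negb_true_iff, ?negb_false_iff in E.
      + left. destruct E as [E1 E2]. split; [easy|]. intros k Hk.
        apply not_true_is_false. intros E3. apply not_true_iff_false in E2.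
        apply E2, ex_ltP. now exists k.
      + right. intros [E1 E2]. destruct E as [E|E]; [congruence|].
        apply ex_ltP in E as (k & Hk & Ek). rewrite E2 in Ek; easy.
    - destruct (Hex a) as [n Hn]. now apply (least_true _ n). }
  exists (fun a => proj1_sig (Hl a)). split.
  - assert (Hc : Computable (fun q : A * nat => if P (fst q) (snd q) then 0 else 1)) by comp.
    destruct Hc as [c Hc]. exists (Mu c). intros a.
    destruct (Hl a) as (m & Hm & Hk). cbn [proj1_sig enc enc_nat]. split.
    + specialize (Hc (a, m)). cbn [fst snd] in Hc. now rewrite Hm in Hc.
    + intros z Hz. exists 0. specialize (Hc (a, z)). cbn [fst snd] in Hc.
      now rewrite Hk in Hc.
  - intros a. now destruct (Hl a).
Qed.

Definition knum (i : nat) : nat :=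
  nat_rect (fun _ => nat) (encode Zero)
    (fun _ r => cpair 5 (cpair (encode Succ) r)) i.

(** For [e = encode c] this is the number of [c] composed with the map sending [x] to [<i,x>];
    [Pair Fst Snd] is the identity program. *)
Definition smn (e i : nat) : nat :=
  cpair 5 (cpair e (cpair 4 (cpair (knum i) (encode (Pair Fst Snd))))).

Lemma comp_smn {A} `{Enc A} (f g : A -> nat) :
  Computable f -> Computable g -> Computable (fun a => smn (f a) (g a)).
Proof. intros Hf Hg. unfold smn, knum. comp. Qed.

Lemma knum_spec i : exists c, encode c = knum i /\ forall x, eval c x i.
Proof.
  induction i as [|i (c & Hc & He)].
  - now exists Zero.
  - exists (Comp Succ c). split; [cbn; now rewrite Hc|]. intros x. exists i. now split.
Qed.

Lemma W_smn c i x : W (smn (encode c) i) x <-> exists y, eval c (cpair i x) y.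
Proof.
  destruct (knum_spec i) as (k & Hk & He).
  assert (Hp : eval (Pair k (Pair Fst Snd)) x (cpair i x)).
  { exists i, x. split; [apply He|]. split; [|easy].
    exists (pi1 x), (pi2 x). rewrite cpair_pi. repeat split. }
  assert (Hs : encode (Comp c (Pair k (Pair Fst Snd))) = smn (encode c) i).
  { cbn. now rewrite Hk. }
  split.
  - intros (d & Hd & y & Hy). rewrite <- Hs in Hd. apply encode_inj in Hd. subst d.
    destruct Hy as (z & Hz & Hy). exists y.
    now rewrite (eval_det _ _ _ _ Hp Hz).
  - intros [y Hy]. eexists. split; [exact Hs|]. exists y, (cpair i x). now split.
Qed.

Lemma semidecider {A} `{Enc A} (R : A -> nat -> bool) :
  Computable (fun q : A * nat => R (fst q) (snd q)) ->
  exists c, forall a, (exists y, eval c (enc a) y) <-> exists s, R a s = true.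
Proof.
  intros HR.
  assert (Hc : Computable (fun q : A * nat => if R (fst q) (snd q) then 0 else 1)) by comp.
  destruct Hc as [c Hc]. exists (Mu c). intros a. split.
  - intros (y & Hy & _). exists y. specialize (Hc (a, y)).
    apply (eval_det _ _ _ _ Hy) in Hc. cbn in Hc. now destruct (R a y).
  - intros [s Hs]. destruct (least_true _ s Hs) as (m & Hm & Hk).
    exists m. split.
    + specialize (Hc (a, m)). cbn [fst snd] in Hc. now rewrite Hm in Hc.
    + intros z Hz. exists 0. specialize (Hc (a, z)). cbn [fst snd] in Hc.
      now rewrite Hk in Hc.
Qed.

Lemma ce_family {A} `{Enc A} (R : A -> nat -> nat -> bool) :
  Computable (fun q : A * (nat * nat) => R (fst q) (fst (snd q)) (snd (snd q))) ->
  exists f, Computable f /\ forall a x, W (f a) x <-> exists s, R a x s = true.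
Proof.
  intros HR. destruct (semidecider (fun p : A * nat => R (fst p) (snd p))) as [c Hc].
  { comp. }
  exists (fun a => smn (encode c) (enc a)). split.
  - apply comp_smn; comp.
  - intros a x. rewrite W_smn. apply (Hc (a, x)).
Qed.

(** Kleene's recursion theorem: [c] semidecides [R (smn n n)] on input [<n,x>], and specialising it
    to its own number makes [smn n n] the index sought. *)
Lemma ce_fixpoint (R : nat -> nat -> nat -> bool) :
  Computable (fun q : nat * (nat * nat) => R (fst q) (fst (snd q)) (snd (snd q))) ->
  exists i, forall x, W i x <-> exists s, R i x s = true.
Proof.
  intros HR.
  destruct (semidecider (fun p : nat * nat => R (smn (fst p) (fst p)) (snd p))) as [c Hc].
  { comp. apply comp_smn; comp. }
  exists (smn (encode c) (encode c)). intros x. rewrite W_smn. apply (Hc (encode c, x)).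
Qed.

Lemma ce_index (R : nat -> nat -> bool) :
  Computable (fun q : nat * nat => R (fst q) (snd q)) ->
  exists i, forall x, W i x <-> exists s, R x s = true.
Proof. intros HR. apply (ce_fixpoint (fun _ x s => R x s)), (comp_app2 R); comp. Qed.

(** [event R <x,s>]: [s] is the least stage by which every [y <= x] has a witness. *)
Definition event (R : nat -> nat -> bool) (t : nat) : bool :=
  all_lt (S (pi1 t)) (fun y => ex_lt (S (pi2 t)) (R y)) &&
  (Nat.eqb (pi2 t) 0 || negb (all_lt (S (pi1 t)) (fun y => ex_lt (pi2 t) (R y)))).

Lemma comp_event {A} `{Enc A} (R : A -> nat -> nat -> bool) (t : A -> nat) :
  Computable (fun q : A * (nat * nat) => R (fst q) (fst (snd q)) (snd (snd q))) ->
  Computable t -> Computable (fun a => event (R a) (t a)).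
Proof.
  intros HR Ht. unfold event. comp.
Qed.

Definition infinitely_often (P : nat -> bool) : Prop :=
  forall b, exists t, b <= t /\ P t = true.

Lemma event_witness R t y : event R t = true -> y <= pi1 t -> exists s, R y s = true.
Proof.
  unfold event. rewrite andb_true_iff, all_ltP. intros [He _] Hy.
  specialize (He y ltac:(lia)). apply ex_ltP in He as (s & _ & Hs). now exists s.
Qed.

Lemma event_unique R t t' :
  event R t = true -> event R t' = true -> pi1 t = pi1 t' -> t = t'.
Proof.
  enough (Hlt : forall t t', event R t = true -> event R t' = true ->
    pi1 t = pi1 t' -> pi2 t < pi2 t' -> False).
  { intros Ht Ht' E. rewrite <- (cpair_pi t), <- (cpair_pi t'). f_equal; [easy|].
    destruct (lt_eq_lt_dec (pi2 t) (pi2 t')) as [[L|E2]|L]; [|easy|];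
      exfalso; eauto. }
  clear. unfold event. intros t t' Ht Ht' E L.
  rewrite andb_true_iff in Ht, Ht'. destruct Ht as [Ht _], Ht' as [_ Ht'].
  rewrite orb_true_iff, Nat.eqb_eq, negb_true_iff in Ht'.
  destruct Ht' as [Ht'|Ht']; [lia|]. apply not_true_iff_false in Ht'. apply Ht'.
  apply all_ltP. intros y Hy. rewrite <- E in Hy.
  apply (proj1 (all_ltP _ _) Ht) in Hy. apply ex_ltP in Hy as (s & Hs & HR).
  apply ex_ltP. exists s. split; [lia|easy].
Qed.

(** Each [x] is the first component of at most one event, so infinitely many events have unbounded
    first components. Conversely, if witnesses always exist, every [x] has its least stage. *)
Lemma event_infinite R :
  (forall x, exists s, R x s = true) <-> infinitely_often (event R).
Proof.
  split.
  - intros Hall b.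
    assert (Hb : forall n, exists s, all_lt n (fun y => ex_lt s (R y)) = true).
    { induction n as [|n [s IH]]; [now exists 0|]. destruct (Hall n) as [s' Hs'].
      exists (S (s + s')). apply all_ltP. intros y Hy. apply ex_ltP.
      destruct (Nat.eq_dec y n) as [->|N]; [exists s'; split; [lia|easy]|].
      pose proof (proj1 (all_ltP _ _) IH y ltac:(lia)) as Hy2. cbv beta in Hy2.
      apply ex_ltP in Hy2 as (k & Hk & HR). exists k. split; [lia|easy]. }
    destruct (Hb (S b)) as [s Hs].
    destruct (least_true (fun s => all_lt (S b) (fun y => ex_lt (S s) (R y))) s)
      as (m & Hm & Hlt).
    { apply all_ltP. intros y Hy. apply (proj1 (all_ltP _ _) Hs) in Hy.
      apply ex_ltP in Hy as (k & Hk & HR). apply ex_ltP. exists k. split; [lia|easy]. }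
    exists (cpair b m). split; [pose proof (cpair_ge b m); lia|].
    unfold event. rewrite pi1_cpair, pi2_cpair, Hm. destruct m as [|m]; [easy|].
    now rewrite (Hlt m) by lia.
  - intros Hinf x.
    assert (HB : forall n, exists B, forall t, event R t = true -> pi1 t < n -> t < B).
    { induction n as [|n [B IH]]; [exists 0; intros; lia|].
      destruct (classic (exists t, event R t = true /\ pi1 t = n)) as [(t0 & H0 & E0)|N].
      - exists (S (B + t0)). intros t Ht Hn. destruct (Nat.eq_dec (pi1 t) n) as [E|].
        + rewrite (event_unique R t t0); trivial; [lia|congruence].
        + specialize (IH t Ht ltac:(lia)). lia.
      - exists B. intros t Ht Hn. apply IH; [easy|].
        enough (pi1 t <> n) by lia. intros E. apply N. now exists t. }
    destruct (HB x) as [B HBx]. destruct (Hinf B) as (t & Hle & Ht).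
    apply (event_witness R t); [easy|].
    destruct (le_lt_dec x (pi1 t)) as [|L]; [easy|]. specialize (HBx t Ht L). lia.
Qed.

(** Matrix of a [Pi^0_2] form of [W i x <-> W j y]: whatever one side shows by stage [r], the other
    shows by stage [s]. *)
Definition agree (i j x y r s : nat) : bool :=
  (negb (Wst i x r) || Wst j y s) && (negb (Wst j y r) || Wst i x s).

Lemma agreeP i j x y :
  (forall r, exists s, agree i j x y r s = true) <-> (W i x <-> W j y).
Proof.
  rewrite !W_Wst. split.
  - intros Ha. split; intros [r Hr]; destruct (Ha r) as [s Hs]; exists s;
      unfold agree in Hs; rewrite Hr in Hs; apply andb_true_iff in Hs as [H1 H2];
      [exact H1|exact H2].
  - intros E r. unfold agree. destruct (Wst i x r) eqn:Ei, (Wst j y r) eqn:Ej.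
    + exists r. now rewrite Ei, Ej.
    + destruct (proj1 E (ex_intro _ _ Ei)) as [s Hs]. exists s. now rewrite Hs.
    + destruct (proj2 E (ex_intro _ _ Ej)) as [s Hs]. exists s. now rewrite Hs.
    + now exists 0.
Qed.

Lemma comp_agree {A} `{Enc A} (i j x y r s : A -> nat) :
  Computable i -> Computable j -> Computable x -> Computable y -> Computable r ->
  Computable s ->
  Computable (fun a => agree (i a) (j a) (x a) (y a) (r a) (s a)).
Proof. intros. unfold agree. comp; apply comp_Wst; comp. Qed.

Lemma eq_ce_agree i j :
  eq_ce i j <-> forall xr, exists s, agree i j (pi1 xr) (pi1 xr) (pi2 xr) s = true.
Proof.
  split.
  - intros E xr. now apply agreeP.
  - intros Ha x. apply agreeP. intros r. destruct (Ha (cpair x r)) as [s Hs].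
    rewrite pi1_cpair, pi2_cpair in Hs. now exists s.
Qed.

(** * Nonreducibility of [E0_ce] to [eq_ce] *)

Lemma le_list_max l x : In x l -> x <= list_max l.
Proof.
  pose proof (proj1 (list_max_le l (list_max l)) (le_n _)) as Hm.
  rewrite Forall_forall in Hm. apply Hm.
Qed.

Lemma infinite_not_finite (P : nat -> bool) :
  infinitely_often P -> ~ finite_set (fun t => P t = true).
Proof.
  intros Hi [l Hl]. destruct (Hi (S (list_max l))) as (t & Hle & Ht).
  apply Hl, le_list_max in Ht. lia.
Qed.

Lemma bounded_finite (P : nat -> Prop) b : (forall t, P t -> t < b) -> finite_set P.
Proof. intros Hb. exists (seq 0 b). intros t Ht. apply in_seq. specialize (Hb t Ht). lia. Qed.

(** By the recursion theorem, let [W i] collect the events confirming [W (f i) = W (f e0)], where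
    [W e0] is empty. Then [W i] is infinite exactly when these sets are equal, that is, when [f]
    claims [W i] to be finite. *)
Lemma E0_not_reducible_eq : ~ reducible E0_ce eq_ce.
Proof.
  intros (f & Hf & Hred). apply Computable_computable in Hf.
  destruct (ce_index (fun _ _ => false)) as [e0 He0]; [comp|].
  destruct (ce_fixpoint (fun i t _ =>
    event (fun xr => agree (f i) (f e0) (pi1 xr) (pi1 xr) (pi2 xr)) t)) as [i Hi].
  { apply (comp_event (fun (q : nat * (nat * nat)) xr =>
      agree (f (fst q)) (f e0) (pi1 xr) (pi1 xr) (pi2 xr))); comp.
    apply comp_agree; comp. }
  assert (HW : forall x, W i x <-> 
    event (fun xr => agree (f i) (f e0) (pi1 xr) (pi1 xr) (pi2 xr)) x = true).
  { intros x. rewrite Hi. split; [now intros [_ ?]|]. now exists 0. }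
  specialize (Hred i e0).
  rewrite eq_ce_agree, event_infinite in Hred.
  destruct (classic (E0_ce i e0)) as [HE|HE].
  - apply Hred in HE as Hinf. apply (infinite_not_finite _ Hinf).
    destruct HE as [l Hl]. exists l. intros x Hx. apply Hl. left.
    split; [now apply HW|]. rewrite He0. now intros [_ ?].
  - apply HE. assert (Hn := HE). rewrite Hred in Hn.
    apply not_all_ex_not in Hn as [b Hb]. apply (bounded_finite _ b).
    intros x [[Hx _]|[Hx _]]; [|rewrite He0 in Hx; now destruct Hx].
    destruct (le_lt_dec b x) as [L|]; [|easy]. destruct Hb. exists x.
    split; [easy|]. now apply HW.
Qed.

Lemma diagonal_not_ce e : ~ forall x, W e x <-> ~ W x x.
Proof. intros He. specialize (He e). tauto. Qed.

(** * Normal form of [Sigma^0_3] equivalence relations *)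

(** Binary digit [i] of [C]: a cut of [{0..n}] is a number below [pow2 (S n)], so there are finitely
    many for each [n]. *)
Definition bit (C i : nat) : bool := Nat.odd (Nat.iter i Nat.div2 C).

Definition pow2 (n : nat) : nat := nat_rect (fun _ => nat) 1 (fun _ r => r + r) n.

Lemma comp_div2 : Computable Nat.div2.
Proof.
  (* Recurrence used: half of [k+1], rounded down, is [k] minus half of [k], rounded down. *)
  apply comp_ext with (fun n => nat_rect (fun _ => nat) 0 (fun k r => k - r) n); [|comp].
  intros n. induction n as [|n IH]; [easy|]. cbn [nat_rect]. rewrite IH.
  pose proof (Nat.div2_odd n). pose proof (Nat.div2_odd (S n)) as H1.
  rewrite Nat.odd_succ, <- Nat.negb_odd in H1.
  destruct (Nat.odd n); cbn [negb Nat.b2n] in *; lia.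
Qed.

Lemma comp_odd : Computable Nat.odd.
Proof.
  apply comp_ext with (fun n => nat_rect (fun _ => bool) false (fun _ r => negb r) n); [|comp].
  intros n. induction n as [|n IH]; [easy|]. cbn [nat_rect]. rewrite IH.
  now rewrite Nat.odd_succ, <- Nat.negb_odd.
Qed.

Lemma comp_bit {A} `{Enc A} (f g : A -> nat) :
  Computable f -> Computable g -> Computable (fun a => bit (f a) (g a)).
Proof.
  intros Hf Hg. unfold bit. apply (comp_comp Nat.odd _ comp_odd).
  apply comp_iter; comp. exact comp_div2.
Qed.

Lemma bit_choice n : forall P : nat -> Prop, exists C, C < pow2 n /\
  (forall i, i < n -> bit C i = true <-> P i).
Proof.
  induction n as [|n IH]; intros P.
  - exists 0. split; [cbn; lia|]. intros; lia.
  - destruct (IH (fun i => P (S i))) as (C & HC & HP).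
    enough (Hb : exists b : bool, b = true <-> P 0).
    { destruct Hb as [b Hb].
      assert (E : Nat.odd (Nat.b2n b + 2 * C) = b /\ Nat.div2 (Nat.b2n b + 2 * C) = C).
      { destruct b; cbn [Nat.b2n plus].
        - split; [now rewrite Nat.odd_succ, Nat.even_mul|].
          apply Nat.div2_succ_double.
        - split; [now rewrite Nat.odd_mul|]. apply Nat.div2_double. }
      destruct E as [E1 E2]. exists (Nat.b2n b + 2 * C). split.
      { cbn [pow2 nat_rect]. fold (pow2 n). destruct b; cbn [Nat.b2n]; lia. }
      intros [|i] Hi; unfold bit.
      - cbn [Nat.iter nat_rect]. now rewrite E1.
      - rewrite nat_iter_S, E2. apply HP. lia. }
    destruct (classic (P 0)); [now exists true|]. now exists false.
Qed.

Lemma bounded_union (R : nat -> nat -> Prop) n :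
  (forall a, a < n -> exists B, forall k, R a k -> k < B) ->
  exists B, forall a k, a < n -> R a k -> k < B.
Proof.
  induction n as [|n IH]; intros HR; [exists 0; intros; lia|].
  destruct IH as [B HB]; [intros; apply HR; lia|].
  destruct (HR n ltac:(lia)) as [B' HB']. exists (B + B'). intros a k Ha Hk.
  destruct (Nat.eq_dec a n) as [->|].
  - apply HB' in Hk. lia.
  - apply HB in Hk; lia.
Qed.

(** [b k] is the [k]-th cut of [nat] into two sides, and [dead k s] holds if it has been
    discarded by stage [s]. *)
Record cut_form (S : nat -> nat -> Prop) (b dead : nat -> nat -> bool) : Prop := {
  cut_side : Computable (fun q : nat * nat => b (fst q) (snd q));
  cut_dead : Computable (fun q : nat * nat => dead (fst q) (snd q));
  cut_mono : forall k s t, s <= t -> dead k s = true -> dead k t = true;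
  cut_rel : forall i j, S i j -> exists K, forall k, K <= k ->
    (forall s, dead k s = false) -> b k i = b k j;
  cut_nrel : forall i j, ~ S i j -> forall K, exists k, K <= k /\
    (forall s, dead k s = false) /\ b k i <> b k j
}.

Section CutForm.
Variable S0 : nat -> nat -> Prop.
Hypothesis S_refl : forall i, S0 i i.
Hypothesis S_sym : forall i j, S0 i j -> S0 j i.
Hypothesis S_trans : forall i j k, S0 i j -> S0 j k -> S0 i k.
Variable Q : nat -> nat -> nat -> nat -> bool.
Hypothesis Q_comp : Computable (fun q : nat * (nat * (nat * nat)) =>
  Q (fst q) (fst (snd q)) (fst (snd (snd q))) (snd (snd (snd q)))).
Hypothesis Q_spec : forall i j, S0 i j <-> exists m, infinitely_often (Q i j m).

(** [C] is caught separating a pair for which some witness makes progress. Since only triples up to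
    [n] are watched, a cut that separates no related pair fires finitely often. *)
Let fire (n C s : nat) : bool :=
  ex_lt (S n) (fun i => ex_lt (S n) (fun j => negb (Bool.eqb (bit C i) (bit C j)) &&
    ex_lt (S n) (fun m => Q i j m s))).

Lemma fireP n C s : fire n C s = true <-> exists i j m, i <= n /\ j <= n /\ m <= n /\
  bit C i <> bit C j /\ Q i j m s = true.
Proof.
  unfold fire. rewrite ex_ltP. split.
  - intros (i & Hi & HP). apply ex_ltP in HP as (j & Hj & HP).
    apply andb_true_iff in HP as [Hb HP]. apply ex_ltP in HP as (m & Hm & HP).
    exists i, j, m. repeat split; try lia; trivial.
    intros E. rewrite E, eqb_reflx in Hb. discriminate Hb.
  - intros (i & j & m & Hi & Hj & Hm & Hb & HQ). exists i. split; [lia|].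
    apply ex_ltP. exists j. split; [lia|]. apply andb_true_iff. split.
    + apply eqb_false_iff in Hb. now rewrite Hb.
    + apply ex_ltP. exists m. split; [lia|easy].
Qed.

Let born (n C t : nat) : bool :=
  Nat.ltb C (pow2 (S n)) && (Nat.eqb t 0 || fire n C (pred t)).

(** The object [<<n,C>,t>] is the cut [C] of [{0..n}] between two consecutive firings of [C],
    the first of them at stage [t-1]. *)
Let dead (k s : nat) : bool :=
  negb (born (pi1 (pi1 k)) (pi2 (pi1 k)) (pi2 k)) ||
  ex_lt s (fun r => Nat.leb (pi2 k) r && fire (pi1 (pi1 k)) (pi2 (pi1 k)) r).

Lemma comp_fire : Computable (fun q : nat * (nat * nat) =>
  fire (fst q) (fst (snd q)) (snd (snd q))).
Proof.
  unfold fire. comp; try (apply comp_bit; comp).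
  exact (comp_comp _ (fun q : nat * (nat * nat) * nat * nat * nat =>
    (snd (fst (fst q)), (snd (fst q), (snd q, snd (snd (fst (fst (fst q)))))))) Q_comp
    ltac:(comp)).
Qed.

Lemma immortalP n C t : (forall s, dead (cpair (cpair n C) t) s = false) <->
  born n C t = true /\ forall r, t <= r -> fire n C r = false.
Proof.
  unfold dead. rewrite !pi1_cpair, !pi2_cpair. split.
  - intros Hd. split.
    + specialize (Hd 0). apply orb_false_iff in Hd as [Hd _].
      now apply negb_false_iff.
    + intros r Hr. specialize (Hd (S r)). apply orb_false_iff in Hd as [_ Hd].
      apply not_true_is_false. intros Hf. apply not_true_iff_false in Hd. apply Hd.
      apply ex_ltP. exists r. split; [lia|]. now rewrite (proj2 (Nat.leb_le _ _) Hr).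
  - intros [Hb Hf] s. rewrite Hb. apply not_true_is_false. intros Hd.
    apply ex_ltP in Hd as (r & _ & Hr). apply andb_true_iff in Hr as [Hr Hr'].
    apply Nat.leb_le in Hr. now rewrite Hf in Hr'.
Qed.

Lemma cut_form_of_events : exists b dead, cut_form S0 b dead.
Proof.
  exists (fun k i => bit (pi2 (pi1 k)) i), dead. split.
  - apply comp_bit; comp.
  - pose proof comp_fire. unfold dead, born, pow2. comp.
  - intros k s t Hst. unfold dead. rewrite !orb_true_iff. intros [H|H]; [now left|].
    right. apply ex_ltP in H as (r & Hr & HP). apply ex_ltP. exists r. split; [lia|easy].
  - intros i j HS. apply Q_spec in HS as [m Hm].
    (* A pair [(n, C)] has at most one immortal copy, born after its last firing, so small [n]
       contribute finitely many. For larger [n], any cut separating [i] from [j] watches the witness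
       [m] and fires forever. *)
    assert (HB : exists B, forall n k, n < i + j + m ->
      pi1 (pi1 k) = n /\ (forall s, dead k s = false) -> k < B).
    { apply bounded_union. intros n Hn.
      destruct (bounded_union (fun C k => pi1 (pi1 k) = n /\ pi2 (pi1 k) = C /\
        (forall s, dead k s = false)) (pow2 (S n))) as [B HB].
      - intros C _.
        destruct (classic (exists k0, pi1 (pi1 k0) = n /\ pi2 (pi1 k0) = C /\
          (forall s, dead k0 s = false))) as [(k0 & E1 & E2 & Hd)|N].
        + exists (S k0). intros k (E1' & E2' & Hd').
          rewrite <- (cpair_pi k0), <- (cpair_pi (pi1 k0)), E1, E2 in Hd |- *.
          rewrite <- (cpair_pi k), <- (cpair_pi (pi1 k)), E1', E2' in Hd' |- *.
          apply immortalP in Hd as [Hb Hf], Hd' as [Hb' Hf'].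
          apply andb_true_iff in Hb as [_ Hb], Hb' as [_ Hb'].
          rewrite orb_true_iff, Nat.eqb_eq in Hb, Hb'.
          replace (pi2 k) with (pi2 k0); [lia|].
          destruct (lt_eq_lt_dec (pi2 k) (pi2 k0)) as [[L|E]|L]; [|easy|].
          * destruct Hb as [Hb|Hb]; [lia|]. rewrite Hf' in Hb; [easy|lia].
          * destruct Hb' as [Hb'|Hb']; [lia|]. rewrite Hf in Hb'; [easy|lia].
        + exists 0. intros k Hk. destruct N. now exists k.
      - exists B. intros k [E Hd]. apply (HB (pi2 (pi1 k)) k); [|now repeat split].
        specialize (Hd 0). rewrite <- E.
        apply orb_false_iff in Hd as [Hd _]. apply negb_false_iff in Hd.
        apply andb_true_iff in Hd as [Hd _]. now apply Nat.ltb_lt. }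
    destruct HB as [B HB]. exists B. intros k Hk Hd.
    destruct (lt_dec (pi1 (pi1 k)) (i + j + m)) as [L|L].
    { specialize (HB _ k L (conj eq_refl Hd)). lia. }
    destruct (bool_dec (bit (pi2 (pi1 k)) i) (bit (pi2 (pi1 k)) j)) as [E|N]; [easy|].
    rewrite <- (cpair_pi k), <- (cpair_pi (pi1 k)) in Hd. apply immortalP in Hd as [_ Hf].
    destruct (Hm (pi2 k)) as (s & Hs & HQ). specialize (Hf s Hs).
    apply not_true_iff_false in Hf. destruct Hf. apply fireP.
    exists i, j, m. repeat split; try lia; trivial.
  - intros i j HN K. set (n := i + j + K).
    (* The cut is the class of [i]. No related pair crosses it, so it has a last firing, and the
       copy born then is immortal; [K] is a summand of [n] so that the number of this copy is at
       least [K]. *)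
    destruct (bit_choice (S n) (fun a => S0 a i)) as (C & HC & Hbit).
    assert (HB : exists B, forall s, B <= s -> fire n C s = false).
    { destruct (bounded_union (fun a s => a <= n /\ exists a' m, a' <= n /\ m <= n /\
        bit C a <> bit C a' /\ Q a a' m s = true) (S n)) as [B HB].
      - intros a Ha.
        destruct (bounded_union (fun a' s => a' <= n /\ exists m, m <= n /\
          bit C a <> bit C a' /\ Q a a' m s = true) (S n)) as [B HB].
        + intros a' Ha'.
          destruct (bounded_union (fun m s => 
            bit C a <> bit C a' /\ Q a a' m s = true) (S n)) as [B HB].
          * intros m _.
            destruct (bool_dec (bit C a) (bit C a')) as [E|N].
            { exists 0. now intros s [N _]. }
            assert (Hni : ~ infinitely_often (Q a a' m)).
            { intros Hi. apply N. apply eq_true_iff_eq.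
              rewrite !Hbit by lia.
              assert (HS : S0 a a') by (apply Q_spec; now exists m).
              split; eauto. }
            apply not_all_ex_not in Hni as [B HB]. exists B. intros s [_ Hs].
            destruct (le_lt_dec B s) as [L|]; [|easy]. destruct HB. now exists s.
          * exists B. intros s (_ & m & Hm & Hb & HQ). apply (HB m); [lia|easy].
        + exists B. intros s (_ & a' & m & Ha' & Hm & Hb & HQ).
          apply (HB a'); [lia|]. split; [lia|]. now exists m.
      - exists B. intros s Hs. apply not_true_is_false. intros Hf.
        apply fireP in Hf as (a & a' & m & Ha & Ha' & Hm & Hb & HQ).
        enough (s < B) by lia. apply (HB a); [lia|]. split; [lia|]. now exists a', m. }
    destruct HB as [B HB].
    assert (Ht : exists t, (t = 0 \/ fire n C (pred t) = true) /\
      forall r, t <= r -> fire n C r = false).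
    { revert HB. induction B as [|B IH]; intros HB; [exists 0; now split; [left|]|].
      destruct (fire n C B) eqn:E.
      - exists (S B). split; [now right|easy].
      - apply IH. intros s Hs. destruct (Nat.eq_dec s B) as [->|]; [easy|].
        apply HB. lia. }
    destruct Ht as (t & Ht & Hf). exists (cpair (cpair n C) t). split; [|split].
    + pose proof (cpair_ge (cpair n C) t). pose proof (cpair_ge n C). lia.
    + apply immortalP. split; [|exact Hf]. apply andb_true_iff.
      rewrite orb_true_iff, Nat.eqb_eq, Nat.ltb_lt. now split.
    + rewrite pi1_cpair, pi2_cpair. intros E. apply HN.
      apply S_sym. apply Hbit; [lia|]. rewrite <- E. apply Hbit; [lia|]. apply S_refl.
Qed.

End CutForm.

Lemma cut_form_sigma3 (S0 : nat -> nat -> Prop)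
    (R : nat -> nat -> nat -> nat -> nat -> bool) :
  (forall i, S0 i i) -> (forall i j, S0 i j -> S0 j i) ->
  (forall i j k, S0 i j -> S0 j k -> S0 i k) ->
  Computable (fun q : nat * (nat * nat) * (nat * nat) =>
    R (fst (fst q)) (fst (snd (fst q))) (snd (snd (fst q))) (fst (snd q)) (snd (snd q))) ->
  (forall i j, S0 i j <-> exists m, forall x, exists s, R i j m x s = true) ->
  exists b dead, cut_form S0 b dead.
Proof.
  intros Hr Hs Ht HR HS.
  apply (cut_form_of_events S0 Hr Hs Ht (fun i j m t => event (R i j m) t)).
  - apply (comp_event (fun q : nat * (nat * (nat * nat)) =>
      R (fst q) (fst (snd q)) (fst (snd (snd q))))); comp.
    exact (comp_comp _ (fun q : nat * (nat * (nat * nat)) * (nat * nat) =>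
      ((fst (fst q), (fst (snd (fst q)), fst (snd (snd (fst q))))), snd q)) HR ltac:(comp)).
  - intros i j. rewrite HS. split; intros [m Hm]; exists m; now apply event_infinite.
Qed.

Lemma cut_form_reducible_E0 S0 b dead : cut_form S0 b dead -> reducible S0 E0_ce.
Proof.
  intros [Hb Hd Hm Hrel Hnrel].
  destruct (ce_family (fun i k s => b k i || dead k s)) as (f & Hf & HW); [comp|].
  exists f. split; [now apply Computable_computable|].
  assert (Hsep : forall i j k, sym_diff (W (f i)) (W (f j)) k <->
    (forall s, dead k s = false) /\ b k i <> b k j).
  { intros i j k. unfold sym_diff. rewrite !HW. split.
    - intros [[[s Hs] HN]|[[s Hs] HN]].
      all: split.
      1,3: intros r; apply not_true_is_false; intros E; apply HN; exists r; rewrite E;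
        apply orb_true_r.
      all: intros E; apply HN; exists s; congruence.
    - intros [Hdk HN]. destruct (b k i) eqn:Ei, (b k j) eqn:Ej; try congruence.
      + left. split; [now exists 0|]. intros [s Hs]. now rewrite Hdk in Hs.
      + right. split; [now exists 0|]. intros [s Hs]. now rewrite Hdk in Hs. }
  intros i j. split.
  - intros HS. destruct (Hrel i j HS) as [K HK]. apply (bounded_finite _ K).
    intros k Hk. apply Hsep in Hk as [Hdk HN].
    destruct (le_lt_dec K k) as [L|]; [|easy]. now rewrite HK in HN.
  - intros [l Hl]. apply NNPP. intros HN.
    destruct (Hnrel i j HN (S (list_max l))) as (k & Hle & Hk).
    apply Hsep, Hl, le_list_max in Hk. lia.
Qed.

Lemma cut_form_E0 : exists b dead, cut_form E0_ce b dead.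
Proof.
  apply (cut_form_sigma3 E0_ce
    (fun i j m xr s =>
      Nat.ltb (pi1 xr) m || agree i j (pi1 xr) (pi1 xr) (pi2 xr) s)).
  - intros i. exists []. intros x [[H1 H2]|[H1 H2]]; contradiction.
  - intros i j [l Hl]. exists l. intros x Hx. apply Hl. unfold sym_diff in *. tauto.
  - intros i j k [l Hl] [l' Hl']. exists (l ++ l'). intros x Hx. apply in_app_iff.
    unfold sym_diff in *. specialize (Hl x). specialize (Hl' x).
    destruct (classic (W j x)); tauto.
  - comp. apply comp_agree; comp.
  - intros i j. split.
    + intros [l Hl]. exists (S (list_max l)). intros xr.
      destruct (Nat.ltb_spec (pi1 xr) (S (list_max l))) as [L|L]; [now exists 0|].
      apply agreeP. enough (~ sym_diff (W i) (W j) (pi1 xr)) by (unfold sym_diff in *; tauto).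
      intros Hin. apply Hl, le_list_max in Hin. lia.
    + intros [m Hm]. apply (bounded_finite _ m). intros x Hx.
      destruct (le_lt_dec m x) as [L|]; [|easy].
      enough (W i x <-> W j x) by (unfold sym_diff in *; tauto).
      apply agreeP. intros r. destruct (Hm (cpair x r)) as [s Hs]. exists s.
      rewrite pi1_cpair, pi2_cpair in Hs. now rewrite (proj2 (Nat.ltb_ge _ _) L) in Hs.
Qed.

(** * Actions computable in indices *)

(** Every number is an index, and one permutation may have many indices; the group laws are
    therefore stated pointwise. *)
Record perm_group (p : nat -> nat -> nat) : Prop := {
  pg_comp : Computable (fun q : nat * nat => p (fst q) (snd q));
  pg_one : exists e, forall x, p e x = x;
  pg_mul : forall g h, exists k, forall x, p k x = p g (p h x);
  pg_inv : forall g, exists k, (forall x, p k (p g x) = x) /\ forall x, p g (p k x) = x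
}.

Definition perm_orbit (p : nat -> nat -> nat) (i j : nat) : Prop :=
  exists g, forall x, W i x <-> W j (p g x).

Definition incl_set (A B : nat -> Prop) : Prop := forall x, A x -> B x.

Section Action.
Variables (G : computable_group) (a : ce_action G) (alpha : nat -> nat -> nat).
Hypothesis alpha_comp : computable2_on (fun g _ => carrier G g) alpha.
Hypothesis alpha_spec :
  forall g e, carrier G g -> set_eq (W (alpha g e)) (act a g (W e)).

Lemma act_ext1 g A B x : carrier G g -> is_ce A -> is_ce B ->
  set_eq A B -> act a g A x -> act a g B x.
Proof. intros Hg HA HB E. now apply (act_ext _ a g A B). Qed.

Lemma act_mono g A B : carrier G g -> is_ce A -> is_ce B ->
  incl_set A B -> incl_set (act a g A) (act a g B).
Proof.
  intros Hg HA HB HAB x Hx. apply NNPP. intros HN.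
  pose proof HA as HA'. pose proof HB as HB'.
  apply is_ce_iff_W in HA as [e0 H0], HB as [e1 H1].
  (* [W (h n)] is [A] if [n] is not in [W n], and grows to [B] otherwise. Hence [x] lies in its
     image under [g] exactly when [n] is not in [W n]. *)
  destruct (ce_family (fun n x s => Wst e0 x s || Wst n n s && Wst e1 x s))
    as (h & Hh & HW).
  { comp; apply comp_Wst; comp. }
  assert (Halpha : Computable (alpha g)).
  { destruct alpha_comp as [c Hc].
    destruct (@comp_const nat nat _ _ g) as [k Hk].
    exists (Comp c (Pair k (Pair Fst Snd))). intros n. exists (cpair g n). split.
    - exists g, n. split; [apply (Hk n)|]. split; [|easy].
      exists (pi1 n), (pi2 n). rewrite cpair_pi. now split.
    - now apply Hc. }
  destruct (ce_index (fun n s => Wst (alpha g (h n)) x s)) as [e He].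
  { apply comp_Wst; comp. }
  apply (diagonal_not_ce e). intros n. rewrite He, <- W_Wst, (alpha_spec g _ Hg x).
  split.
  - intros Hn Hnn. apply HN. revert Hn. apply act_ext1; trivial.
    + apply is_ce_iff_W. now exists (h n).
    + intros y. rewrite HW, (H1 y). split.
      * intros [s Hs]. apply orb_true_iff in Hs as [Hs|Hs].
        -- apply H1, HAB, H0, W_Wst. now exists s.
        -- apply andb_true_iff in Hs as [_ Hs]. apply W_Wst. now exists s.
      * intros Hy. apply W_Wst in Hy as [s Hs]. apply W_Wst in Hnn as [r Hr].
        exists (s + r). rewrite (Wst_mono n n r (s + r)), (Wst_mono e1 y s (s + r));
          trivial; lia || apply orb_true_r.
  - intros Hnn. revert Hx. apply act_ext1; trivial.
    + apply is_ce_iff_W. now exists (h n).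
    + intros y. rewrite HW, (H0 y). split.
      * intros Hy. apply W_Wst in Hy as [s Hs]. exists s. now rewrite Hs.
      * intros [s Hs]. apply orb_true_iff in Hs as [Hs|Hs]; [apply W_Wst; now exists s|].
        apply andb_true_iff in Hs as [Hs _]. destruct Hnn. apply W_Wst. now exists s.
Qed.

Lemma is_ce_single x : is_ce (eq x).
Proof.
  apply is_ce_iff_W. destruct (ce_index (fun y _ => Nat.eqb x y)) as [e He]; [comp|].
  exists e. intros y. rewrite He. split; [intros ->; exists 0; apply Nat.eqb_refl|].
  intros [_ E]. now apply Nat.eqb_eq.
Qed.

Lemma is_ce_empty : is_ce (fun _ => False).
Proof.
  apply is_ce_iff_W. destruct (ce_index (fun _ _ => false)) as [e He]; [comp|].
  exists e. intros y. rewrite He. split; [easy|now intros [_ ?]].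
Qed.

Lemma act_inv_l g h A : carrier G g -> carrier G h -> mul G h g = one G -> is_ce A ->
  set_eq (act a h (act a g A)) A.
Proof.
  intros Hg Hh E HA x. rewrite <- (act_mul _ a h g A Hh Hg HA x), E.
  now apply act_one.
Qed.

(** If the image of the singleton were empty, monotonicity would put it inside the image of the
    empty set; applying the inverse puts [x] into the empty set. *)
Lemma act_nonempty g x : carrier G g -> exists y, act a g (eq x) y.
Proof.
  intros Hg. apply NNPP. intros HN.
  destruct (mul_inv G g Hg) as (h & Hh & E & E').
  assert (Hx : act a h (act a g (eq x)) x).
  { now apply (act_inv_l g h (eq x) Hg Hh E (is_ce_single x)). }
  apply (act_inv_l g h _ Hg Hh E is_ce_empty x). revert x Hx HN.
  intros x Hx HN. revert Hx. apply act_mono; trivial.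
  - apply act_ce; [easy|apply is_ce_single].
  - apply act_ce; [easy|apply is_ce_empty].
  - intros y Hy. destruct HN. now exists y.
Qed.

(** The inverse sends [{y}] to a nonempty subset of [{x}], hence to a set containing [x]; applying
    [g] again bounds the image of [{x}] by [{y}]. *)
Lemma act_single g x y : carrier G g -> act a g (eq x) y -> set_eq (act a g (eq x)) (eq y).
Proof.
  intros Hg Hy. destruct (mul_inv G g Hg) as (h & Hh & E & E').
  assert (H1 : incl_set (act a h (eq y)) (eq x)).
  { intros z Hz. apply (act_inv_l g h _ Hg Hh E (is_ce_single x)).
    revert Hz. apply act_mono; trivial; [apply is_ce_single| |].
    - apply act_ce; [easy|apply is_ce_single].
    - intros w <-. exact Hy. }
  assert (H2 : act a h (eq y) x).
  { destruct (act_nonempty h y Hh) as [z Hz]. now rewrite (H1 z Hz). }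
  intros z. split; [|now intros <-]. intros Hz.
  apply (act_inv_l h g _ Hh Hg E' (is_ce_single y)). revert Hz.
  apply act_mono; trivial; [apply is_ce_single| |].
  - apply act_ce; [easy|apply is_ce_single].
  - now intros w <-.
Qed.

(** A point [x] of the pullback of [{y}] by the inverse lies in [A] by monotonicity, and the
    pullback is exactly [{x}]. *)
Lemma act_image g A y : carrier G g -> is_ce A ->
  act a g A y <-> exists x, A x /\ act a g (eq x) y.
Proof.
  intros Hg HA. split.
  - intros Hy. destruct (mul_inv G g Hg) as (h & Hh & E & E').
    destruct (act_nonempty h y Hh) as [x Hx]. exists x. split.
    + apply (act_inv_l g h A Hg Hh E HA). revert Hx.
      apply act_mono; trivial; [apply is_ce_single|now apply act_ce|now intros w <-].
    + apply (act_ext1 g (act a h (eq y)) (eq x)); trivial.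
      * apply act_ce; [easy|apply is_ce_single].
      * apply is_ce_single.
      * now apply act_single.
      * now apply (act_inv_l h g _ Hh Hg E' (is_ce_single y)).
  - intros (x & Hx & Hy). revert Hy.
    apply act_mono; trivial; [apply is_ce_single|now intros w <-].
Qed.

Lemma action_perm_group : exists p, perm_group p /\
  forall i j, orbit_rel G a i j <-> perm_orbit p i j.
Proof.
  destruct (carrier_computable G) as (chi & Hchi & Hcarr).
  assert (Hchi' : Computable chi) by exact (proj2 (Computable_computable _) Hchi).
  (* Numbers outside the carrier are read as the identity, so that every number indexes a
     permutation. *)
  set (gam := fun n => if chi n then n else one G).
  assert (Hgam : Computable gam) by (unfold gam; comp).
  assert (HG : forall n, carrier G (gam n)).
  { intros n. unfold gam. destruct (chi n) eqn:E; [now apply Hcarr|apply one_closed]. }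
  assert (HGid : forall n, carrier G n -> gam n = n).
  { intros n Hn. unfold gam. now rewrite (proj1 (Hcarr n) Hn). }
  set (beta := fun g e => alpha (gam g) e).
  assert (Hbeta : Computable (fun q : nat * nat => beta (fst q) (snd q))).
  { destruct alpha_comp as [c Hc].
    assert (Hp : Computable (fun q : nat * nat => cpair (gam (fst q)) (snd q))) by comp.
    destruct Hp as [c' Hc']. exists (Comp c c'). intros q.
    exists (cpair (gam (fst q)) (snd q)). split; [apply Hc'|]. apply Hc, HG. }
  destruct (ce_family (fun x y (_ : nat) => Nat.eqb x y)) as (sing & Hsing & HW); [comp|].
  assert (HWs : forall x, set_eq (W (sing x)) (eq x)).
  { intros x y. rewrite HW. split; [|intros ->; exists 0; apply Nat.eqb_refl].
    intros [_ E]. now apply Nat.eqb_eq. }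
  assert (Hact : forall g x y, W (beta g (sing x)) y <-> act a (gam g) (eq x) y).
  { intros g x y. unfold beta. rewrite (alpha_spec _ _ (HG g) y).
    apply (act_ext _ a); [apply HG| |apply is_ce_single|apply HWs].
    apply is_ce_iff_W. now exists (sing x). }
  (* The value of the permutation at [x] is the first element to appear in the enumeration of the
     image of [{x}]; [t] pairs it with a stage. *)
  destruct (comp_search (fun (q : nat * nat) t =>
    Wst (beta (fst q) (sing (snd q))) (pi1 t) (pi2 t))) as (f & Hf & Hfs).
  { apply comp_Wst; comp. }
  { intros [g x]. destruct (act_nonempty (gam g) x (HG g)) as [y Hy].
    apply Hact, W_Wst in Hy as [s Hs]. exists (cpair y s).
    now rewrite pi1_cpair, pi2_cpair. }
  set (p := fun g x => pi1 (f (g, x))).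
  assert (Hp : forall g x, set_eq (act a (gam g) (eq x)) (eq (p g x))).
  { intros g x. apply act_single; [apply HG|]. apply Hact, W_Wst.
    exists (pi2 (f (g, x))). apply (Hfs (g, x)). }
  assert (Hpmul : forall g h x, act a (mul G (gam g) (gam h)) (eq x) (p g (p h x))).
  { intros g h x. apply act_mul; [apply HG|apply HG|apply is_ce_single|].
    apply (act_ext1 (gam g) (eq (p h x))); [apply HG|apply is_ce_single| | |].
    - apply act_ce; [apply HG|apply is_ce_single].
    - intros y. symmetry. apply Hp.
    - now apply Hp. }
  assert (Hpmul2 : forall g h k x, gam k = mul G (gam g) (gam h) -> p k x = p g (p h x)).
  { intros g h k x E. apply (Hp k x). rewrite E. apply Hpmul. }
  assert (Hp1 : forall x, p (one G) x = x).
  { intros x. apply Hp. rewrite HGid by apply one_closed. now apply act_one; [apply is_ce_single|]. }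
  exists p. split; [split|].
  - unfold p. comp.
  - exists (one G). exact Hp1.
  - intros g h. exists (mul G (gam g) (gam h)). intros x. apply Hpmul2.
    apply HGid, mul_closed; apply HG.
  - intros g. destruct (mul_inv G (gam g) (HG g)) as (k & Hk & E & E'). exists k.
    split; intros x.
    + rewrite <- (Hpmul2 k g (one G)); [apply Hp1|].
      now rewrite (HGid k Hk), E, HGid by apply one_closed.
    + rewrite <- (Hpmul2 g k (one G)); [apply Hp1|].
      now rewrite (HGid k Hk), E', HGid by apply one_closed.
  - assert (Hinj : forall g x y, p g x = p g y -> x = y).
    { intros g x y E. destruct (mul_inv G (gam g) (HG g)) as (k & Hk & E1 & _).
      rewrite <- (Hp1 x), <- (Hp1 y).
      rewrite !(Hpmul2 k g (one G)); [now rewrite E| |].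
      all: now rewrite (HGid k Hk), E1, HGid by apply one_closed. }
    assert (Hsurj : forall g y, exists x, p g x = y).
    { intros g y. destruct (mul_inv G (gam g) (HG g)) as (k & Hk & _ & E1).
      exists (p k y). rewrite <- (Hpmul2 g k (one G)); [apply Hp1|].
      now rewrite (HGid k Hk), E1, HGid by apply one_closed. }
    assert (Him : forall g i x, act a (gam g) (W i) (p g x) <-> W i x).
    { intros g i x. rewrite act_image; [|apply HG|apply is_ce_iff_W; now exists i].
      split.
      - intros (z & Hz & E). apply Hp, Hinj in E. now subst.
      - intros Hx. exists x. split; [easy|]. now apply Hp. }
    intros i j. split.
    + intros (g & Hg & E). exists g. intros x.
      rewrite <- (E (p g x)), <- (HGid g Hg) at 1. symmetry. apply Him.
    + intros (g & Hg). exists (gam g). split; [apply HG|]. intros y.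
      destruct (Hsurj g y) as [x <-]. rewrite Him. apply Hg.
Qed.
End Action.

Lemma orbit_equivalence_perm E : ce_orbit_equivalence E ->
  exists p, perm_group p /\ forall i j, E i j <-> perm_orbit p i j.
Proof.
  intros (G & a & (alpha & Hc & Hs) & HE).
  destruct (action_perm_group G a alpha Hc Hs) as (p & Hp & Ho).
  exists p. split; [exact Hp|]. intros i j. now rewrite HE.
Qed.

(** * Combinatorics of infinite permutation groups *)

Lemma list_choice {X Y} (P : X -> Y -> Prop) (l : list X) :
  exists T, forall x, In x l -> (exists y, P x y) -> exists y, In y T /\ P x y.
Proof.
  induction l as [|x l [T IH]]; [now exists []|].
  destruct (classic (exists y, P x y)) as [[y Hy]|N].
  - exists (y :: T). intros x' [<-|Hx'] He; [exists y; now split; [left|]|].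
    destruct (IH x' Hx' He) as (y' & Hy' & HP). exists y'. now split; [right|].
  - exists T. intros x' [<-|Hx'] He; [contradiction|]. now apply IH.
Qed.

Lemma list_filter {X} (P : X -> Prop) (l : list X) :
  exists l', forall x, In x l' <-> In x l /\ P x.
Proof.
  induction l as [|x l [l' IH]]; [exists []; cbn; tauto|].
  destruct (classic (P x)).
  - exists (x :: l'). intros y. cbn. rewrite IH. split; [|tauto].
    intros [<-|]; tauto.
  - exists l'. intros y. cbn. rewrite IH. split; [tauto|]. intros [[<-|] ?]; tauto.
Qed.

Section Perm.
Variable p : nat -> nat -> nat.
Hypothesis Hp : perm_group p.

Lemma perm_inj g x y : p g x = p g y -> x = y.
Proof.
  intros E. destruct (pg_inv p Hp g) as (k & Hk & _).
  now rewrite <- (Hk x), E, Hk.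
Qed.

Definition stab (Z : list nat) (g : nat) : Prop := forall z, In z Z -> p g z = z.

Definition inf_orbit (Z : list nat) (a : nat) : Prop :=
  forall B : list nat, exists g, stab Z g /\ ~ In (p g a) B.

Lemma stab_comp Z g h k : stab Z g -> stab Z h ->
  (forall x, p k x = p g (p h x)) -> stab Z k.
Proof. intros Hg Hh Hk z Hz. rewrite Hk, (Hh z Hz). now apply Hg. Qed.

Lemma stab_inv Z g k : stab Z g -> (forall x, p k (p g x) = x) -> stab Z k.
Proof. intros Hg Hk z Hz. rewrite <- (Hg z Hz) at 1. apply Hk. Qed.

Lemma inf_orbit_perm Z a h : stab Z h -> inf_orbit Z a -> inf_orbit Z (p h a).
Proof.
  intros Hh Ha B. destruct (Ha B) as (g & Hg & HN).
  destruct (pg_inv p Hp h) as (k & Hk & _). destruct (pg_mul p Hp g k) as [l Hl].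
  exists l. split.
  - apply (stab_comp Z g k); trivial. now apply (stab_inv Z h).
  - now rewrite Hl, Hk.
Qed.

(** Fixing a point with finite orbit only passes to a subgroup of finite index. *)
Lemma inf_orbit_stab Z a : inf_orbit [] a ->
  (forall z, In z Z -> ~ inf_orbit [] z) -> inf_orbit Z a.
Proof.
  intros Ha. induction Z as [|z Z IH]; [easy|]. intros HZ.
  assert (IHZ : inf_orbit Z a) by (apply IH; intros; apply HZ; now right).
  assert (Hz : exists Bz, forall g, In (p g z) Bz).
  { apply NNPP. intros HN. apply (HZ z (or_introl eq_refl)). intros B.
    apply NNPP. intros HN2. apply HN. exists B. intros g. apply NNPP. intros HN3.
    apply HN2. now exists g. }
  destruct Hz as [Bz HBz]. intros B.
  destruct (list_choice (fun c t => stab Z t /\ p t z = c) Bz) as [T HT].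
  destruct (IHZ (flat_map (fun t => map (p t) B) T)) as (k & Hk & HkB).
  destruct (HT (p k z) (HBz k)) as (t & Ht & Hts & Htz); [now exists k|].
  destruct (pg_inv p Hp t) as (t' & Ht1 & Ht2). destruct (pg_mul p Hp t' k) as [g Hg].
  exists g. split.
  - intros y [<-|Hy]; [now rewrite Hg, <- Htz|].
    apply (stab_comp Z t' k g); trivial. now apply (stab_inv Z t).
  - intros Hin. apply HkB, in_flat_map. exists t. split; [easy|].
    apply in_map_iff. exists (p g a). split; [now rewrite Hg|easy].
Qed.

(** P. M. Neumann's separation lemma. If [h] moves [A] away from [B] and from [s^-1 B] for
    finitely many [s], and still maps [a] into [B], then one of these [s] moves [h a]
    out of [B], and [s h] separates [a :: A] from [B]. *)
Lemma separation Z A : (forall a, In a A -> inf_orbit Z a) ->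
  forall B, exists g, stab Z g /\ forall a, In a A -> ~ In (p g a) B.
Proof.
  induction A as [|a A IH]; intros HA B.
  - destruct (pg_one p Hp) as [e He]. exists e. split; [intros z _; apply He|easy].
  - destruct (list_choice (fun b t => exists s, stab Z s /\ (forall x, p t (p s x) = x)
      /\ ~ In (p s b) B) B) as [T HT].
    destruct (IH (fun x Hx => HA x (or_intror Hx)) (B ++ flat_map (fun t => map (p t) B) T))
      as (h & Hh & HhB).
    destruct (classic (In (p h a) B)) as [Hin|HN].
    + destruct (HT _ Hin) as (t & Ht & s & Hs & Hts & HsB).
      { destruct (inf_orbit_perm Z a h Hh (HA a (or_introl eq_refl)) B) as (s & Hs & HN).
        destruct (pg_inv p Hp s) as (t & Ht & _). now exists t, s. }
      destruct (pg_mul p Hp s h) as [g Hg]. exists g.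
      split; [now apply (stab_comp Z s h)|]. intros x [<-|Hx]; rewrite Hg; [easy|].
      intros Hxin. apply (HhB x Hx), in_app_iff. right. apply in_flat_map.
      exists t. split; [easy|]. apply in_map_iff. now exists (p s (p h x)).
    + exists h. split; [easy|]. intros x [<-|Hx]; [easy|]. intros Hxin.
      apply (HhB x Hx), in_app_iff. now left.
Qed.

Definition infinite_image : Prop :=
  forall l : list nat, exists g, forall h, In h l -> exists x, p g x <> p h x.

Definition all_moved : Prop := forall Z, exists v y, stab Z v /\ p v y <> y.

(** With finite orbits, a finite list [l] realises all restrictions to [Z]. An element outside [l],
    divided by the member of [l] agreeing with it on [Z], fixes [Z] and is not the identity. *)
Lemma finite_orbits_moved :
  infinite_image -> (forall a, ~ inf_orbit [] a) -> all_moved.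
Proof.
  intros Hinf Hfin Z.
  assert (Hl : exists l, forall g, exists h, In h l /\ forall z, In z Z -> p g z = p h z).
  { induction Z as [|z Z [l IH]].
    - exists [0]. intros g. exists 0. now split; [left|].
    - assert (Hz : exists Bz, forall g, In (p g z) Bz).
      { apply NNPP. intros HN. apply (Hfin z). intros B.
        apply NNPP. intros HN2. apply HN. exists B. intros g. apply NNPP. intros HN3.
        apply HN2. now exists g. }
      destruct Hz as [Bz HBz].
      destruct (list_choice (fun hc t => (forall y, In y Z -> p t y = p (fst hc) y) /\
        p t z = snd hc) (list_prod l Bz)) as [T HT].
      exists T. intros g. destruct (IH g) as (h & Hh & Hag).
      destruct (HT (h, p g z)) as (t & Ht & Ht1 & Ht2).
      { now apply in_prod. }
      { exists g. now split. }
      exists t. split; [easy|]. intros y [<-|Hy]; [easy|].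
      rewrite Hag, Ht1; easy. }
  destruct Hl as [l Hl]. destruct (Hinf l) as [g Hg].
  destruct (Hl g) as (h & Hh & Hag). destruct (Hg h Hh) as [x Hx].
  destruct (pg_inv p Hp h) as (k & Hk & Hk'). destruct (pg_mul p Hp k g) as [v Hv].
  exists v, x. split.
  - intros z Hz. now rewrite Hv, Hag, Hk.
  - rewrite Hv. intros E. apply Hx. rewrite <- E at 2. now rewrite Hk'.
Qed.

(** One round of the coding: [D] is the current core, [N] is the finite set kept out of it,
    [w] is the group element assigned to a new cut and [D'] is the next core. *)
Definition extends (D N F : list nat) (w : nat) (D' : list nat) : Prop :=
  incl D D' /\ (forall x, In x D -> exists y, In y D' /\ p w y = x) /\
  (forall y, In y D' -> ~ In y N /\ ~ In (p w y) N) /\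
  forall h, In h F -> exists y, In y D' /\ forall y', In y' D' -> p h y <> p w y'.

(** [z] is a point of infinite orbit outside [D], [N] and the preimages of [D] under [F]. The
    element [w] fixes the points of [D] and [N] with finite orbit and moves [z] and the others away
    from [D], [N] and all [h z]. With [D'] consisting of [z], [D] and the preimage of [D] under [w],
    no [h z] lies in the image of [D']. *)
Lemma extends_infinite_orbit D N F z0 : (forall x, In x D -> ~ In x N) ->
  inf_orbit [] z0 -> exists w D', extends D N F w D'.
Proof.
  intros HDN Hz0.
  destruct (list_filter (fun x => ~ inf_orbit [] x) (D ++ N)) as [Z HZ].
  destruct (list_filter (inf_orbit []) (D ++ N)) as [A HA].
  assert (Hinv : exists I, forall h d, In h F -> In d D -> exists y, In y I /\ p h y = d).
  { destruct (list_choice (fun hd y => p (fst hd) y = snd hd) (list_prod F D)) as [I HI].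
    exists I. intros h d Hh Hd. apply (HI (h, d)); [now apply in_prod|].
    destruct (pg_inv p Hp h) as (k & _ & Hk). now exists (p k d). }
  destruct Hinv as [I HI].
  destruct (Hz0 (D ++ N ++ I)) as (g & Hg & Hz). set (z := p g z0) in *.
  rewrite !in_app_iff in Hz.
  assert (Hzinf : inf_orbit [] z) by now apply inf_orbit_perm.
  assert (HhD : forall h, In h F -> ~ In (p h z) D).
  { intros h Hh Hd. destruct (HI h _ Hh Hd) as (y & Hy & E). apply perm_inj in E.
    subst y. tauto. }
  destruct (separation Z (z :: A)) with (B := D ++ N ++ map (fun h => p h z) F)
    as (w & Hw & HwB).
  { intros a Ha. apply inf_orbit_stab; [|intros x Hx; now apply HZ].
    destruct Ha as [<-|Ha]; [easy|now apply HA]. }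
  assert (Hcase : forall x, In x (D ++ N) -> p w x = x \/
     ~ In (p w x) (D ++ N ++ map (fun h => p h z) F)).
  { intros x Hx. destruct (classic (inf_orbit [] x)) as [Hi|Hf].
    - right. apply HwB. right. now apply HA.
    - left. now apply Hw, HZ. }
  destruct (pg_inv p Hp w) as (k & Hk & Hk').
  exists w, (z :: D ++ map (p k) D). split; [|split; [|split]].
  - intros x Hx. right. apply in_app_iff. now left.
  - intros x Hx. exists (p k x). split; [|easy]. right. apply in_app_iff. right. now apply in_map.
  - assert (HwzN : ~ In (p w z) (D ++ N ++ map (fun h => p h z) F)) by (apply HwB; now left).
    rewrite !in_app_iff in HwzN.
    intros y [<-|Hy]; [tauto|]. apply in_app_iff in Hy as [Hy|Hy].
    + split; [now apply HDN|]. destruct (Hcase y) as [E|HN].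
      * apply in_app_iff. now left.
      * rewrite E. now apply HDN.
      * rewrite !in_app_iff in HN. tauto.
    + apply in_map_iff in Hy as (d & <- & Hd). rewrite Hk'. split; [|now apply HDN].
      intros Hn. destruct (Hcase (p k d)) as [E|HN].
      * apply in_app_iff. now right.
      * rewrite Hk' in E. rewrite <- E in Hn. now apply (HDN d).
      * rewrite Hk', !in_app_iff in HN. tauto.
  - intros h Hh. exists z. split; [now left|].
    assert (Hhz : In (p h z) (map (fun h => p h z) F)) by (apply in_map_iff; now exists h).
    intros y [<-|Hy] E; [|apply in_app_iff in Hy as [Hy|Hy]].
    + apply (HwB z); [now left|]. rewrite <- E, !in_app_iff. tauto.
    + destruct (Hcase y) as [E2|HN].
      * apply in_app_iff. now left.
      * apply (HhD h Hh). now rewrite E, E2.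
      * apply HN. rewrite <- E, !in_app_iff. tauto.
    + apply in_map_iff in Hy as (d & <- & Hd). apply (HhD h Hh). now rewrite E, Hk'.
Qed.

(** Here [w] fixes [D] and [N] pointwise, so only the last clause of [extends] takes work. The
    elements of [F] are treated one by one, adding at most one point to the core each time. *)
Lemma extends_all_moved D N F : (forall x, In x D -> ~ In x N) ->
  all_moved -> exists w D', extends D N F w D'.
Proof.
  intros HDN Hmv.
  enough (HP : exists w X, stab (D ++ N) w /\ incl D X /\ (forall x, In x X -> ~ In x N) /\
    forall h, In h F -> exists y, In y X /\ forall y', In y' X -> p h y <> p w y').
  { destruct HP as (w & X & Hw & HX & HXN & Hh). exists w, X.
    split; [easy|]. split; [|split; [|easy]].
    - intros x Hx. exists x. split; [now apply HX|]. apply Hw, in_app_iff. now left.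
    - intros y Hy. split; [now apply HXN|]. intros Hn.
      assert (E : p w (p w y) = p w y) by (apply Hw, in_app_iff; now right).
      apply perm_inj in E. rewrite E in Hn. now apply (HXN y). }
  induction F as [|h0 F (w & X & Hw & HX & HXN & Hh)].
  - destruct (pg_one p Hp) as [e He]. exists e, D. split; [intros z _; apply He|].
    split; [easy|]. now split.
  - destruct (classic (exists y, In y X /\ forall y', In y' X -> p h0 y <> p w y'))
      as [He|HN].
    { exists w, X. split; [easy|]. split; [easy|]. split; [easy|].
      intros h [<-|Hin]; [easy|now apply Hh]. }
    destruct (pg_inv p Hp w) as (k & Hk & Hk'). destruct (pg_inv p Hp h0) as (k0 & Hk0 & Hk0').
    (* Besides [D], [N] and [X], the new [y] must avoid the points that [h0] sends into the image of
       [X], and the points that [w] sends to some [h x]; the latter protects the witnesses already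
       found. *)
    destruct (Hmv (D ++ N ++ X ++ map (fun y => p k0 (p w y)) X ++
      flat_map (fun h => map (fun y => p k (p h y)) X) F)) as (v & y & Hv & Hvy).
    assert (Hyout : forall z, In z (D ++ N ++ X ++ map (fun y => p k0 (p w y)) X ++
      flat_map (fun h => map (fun y => p k (p h y)) X) F) -> z <> y /\ z <> p v y).
    { intros z Hz. apply Hv in Hz. split; intros ->; [easy|].
      now apply perm_inj in Hz. }
    setoid_rewrite in_app_iff in Hyout. setoid_rewrite in_app_iff in Hyout.
    setoid_rewrite in_app_iff in Hyout. setoid_rewrite in_app_iff in Hyout.
    (* If [w] and [h0] disagree at [y], then [w] can stay; otherwise [w] after [v] moves the value
       at [y] and keeps all values on [X]. *)
    assert (Hw' : exists w', stab (D ++ N) w' /\ (forall x, In x X -> p w' x = p w x) /\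
      (p w' y = p w y \/ p w' y = p w (p v y)) /\ p w' y <> p h0 y).
    { destruct (Nat.eq_dec (p w y) (p h0 y)) as [E|E].
      - destruct (pg_mul p Hp w v) as [w' Hw']. exists w'.
        assert (HvDN : stab (D ++ N) v).
        { intros z Hz. apply Hv. rewrite !in_app_iff in *. tauto. }
        split; [now apply (stab_comp (D ++ N) w v)|]. split; [|split].
        + intros x Hx. rewrite Hw', Hv; [easy|]. rewrite !in_app_iff. tauto.
        + right. apply Hw'.
        + rewrite Hw', <- E. intros E2. now apply perm_inj in E2.
      - exists w. repeat split; trivial. now left. }
    destruct Hw' as (w' & Hw's & Hw'X & Hw'y & Hne).
    exists w', (y :: X). split; [easy|]. split; [now apply incl_tl|]. split.
    + intros x [<-|Hx]; [|now apply HXN]. intros Hn. destruct (Hyout y) as [C _]; [tauto|easy].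
    + intros h [<-|Hin].
      * exists y. split; [now left|]. intros y' [<-|Hy'] E; [congruence|].
        rewrite Hw'X in E by easy. destruct (Hyout (p k0 (p w y'))) as [C _].
        -- right. right. right. left. apply in_map_iff. now exists y'.
        -- apply C. now rewrite <- E, Hk0.
      * destruct (Hh h Hin) as (x & Hx & Hxw). exists x. split; [now right|].
        intros y' [<-|Hy'] E; [|apply (Hxw y' Hy'); now rewrite <- Hw'X].
        destruct (Hyout (p k (p h x))) as [H1 H2].
        { right. right. right. right. apply in_flat_map. exists h. split; [easy|].
          apply in_map_iff. now exists x. }
        rewrite E in H1, H2. destruct Hw'y as [E'|E']; rewrite E', Hk in H1, H2; congruence.
Qed.

Lemma extends_exists D N F : infinite_image -> (forall x, In x D -> ~ In x N) ->
  exists w D', extends D N F w D'.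
Proof.
  intros Hinf HDN. destruct (classic (exists z, inf_orbit [] z)) as [[z Hz]|HN].
  - now apply (extends_infinite_orbit D N F z).
  - apply extends_all_moved; [easy|]. apply finite_orbits_moved; [easy|].
    intros a Ha. apply HN. now exists a.
Qed.

End Perm.

(** * Coding a normal form into the orbit relation *)

Definition mem (x : nat) (l : list nat) : bool := existsb (Nat.eqb x) l.

Lemma memP x l : mem x l = true <-> In x l.
Proof.
  unfold mem. rewrite existsb_exists. split.
  - intros (y & Hy & E). apply Nat.eqb_eq in E. now subst.
  - intros Hx. exists x. split; [easy|apply Nat.eqb_refl].
Qed.

Lemma comp_mem {A} `{Enc A} (f : A -> nat) (l : A -> list nat) :
  Computable f -> Computable l -> Computable (fun a => mem (f a) (l a)).
Proof. intros Hf Hl. unfold mem. comp. Qed.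

Ltac comp_hook3 :=
  lazymatch goal with
  | |- Computable (fun a => mem _ _) => apply comp_mem; comp
  | |- Computable (fun a => Wst _ _ _) => apply comp_Wst; comp
  | |- _ => comp_hook2
  end.
Ltac comp_hook ::= comp_hook3.

(** [(k, (w, N))]: cut [k] is coded by the group element [w]; [N] is kept out of the core. *)
Definition entry : Type := (nat * (nat * list nat))%type.

(** [(L, (D, (K, n)))]: active entries (latest first), core, next cut, search counter. *)
Definition cstate : Type := (list entry * (list nat * (nat * nat)))%type.

Section Coding.
Variable p : nat -> nat -> nat.
Hypothesis Hp : perm_group p.
Hypothesis Hinf : infinite_image p.
Variable S0 : nat -> nat -> Prop.
Variables b dead : nat -> nat -> bool.
Hypothesis Hcut : cut_form S0 b dead.

Let p_comp := pg_comp p Hp.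
Let b_comp := cut_side S0 b dead Hcut.
Let dead_comp := cut_dead S0 b dead Hcut.

Definition move (i y : nat) (e : entry) : nat :=
  if b (fst e) i then p (fst (snd e)) y else y.

(** The permutation [u_i]. Entries come newest first, so the newest acts first on a core point and
    the oldest last. *)
Definition coord (L : list entry) (i x : nat) : nat := fold_left (move i) L x.

Definition topN (L : list entry) : list nat := snd (snd (hd (0, (0, [])) L)).

(** Decidable test of a candidate [(w, (D', N'))]. [D] must lie in both [D'] and its image under
    [w], so that every [V_i] grows whichever side [i] is on; forbidden points are carried over
    likewise. In the last clause, if [j] is on the right and [i] on the left, [y] gives a point of
    [V_j] that [g] sends to a point kept out of [V_i] by [z]. *)
Definition check (L : list entry) (D : list nat) (K : nat)
    (c : nat * (list nat * list nat)) : bool :=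
  let w := fst c in let D' := fst (snd c) in let N' := snd (snd c) in
  forallb (fun x => mem x D' && mem x (map (p w) D')) D &&
  forallb (fun y => negb (mem y N')) D' &&
  forallb (fun x => mem x N' && mem x (map (p w) N')) (topN L) &&
  all_lt (S K) (fun i => all_lt (S K) (fun j => all_lt (S K) (fun g =>
    existsb (fun y => existsb (fun z =>
      Nat.eqb (p g (coord L j y)) (coord L i (p w z))) N') D'))).

(** Each stage does one thing. If any active cut is dead, however deep, the newest one is popped and
    [K] returns to its number, so that an innocent victim is coded afresh. Otherwise a dead next cut
    is skipped, or one more candidate is tested; the search restarts at 0 after every other
    change. *)
Definition cstep (s : nat) (st : cstate) : cstate :=
  let L := fst st in let D := fst (snd st) in
  let K := fst (snd (snd st)) in let n := snd (snd (snd st)) in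
  let e := hd (0, (0, [])) L in
  let c : nat * (list nat * list nat) := dec n in
  if existsb (fun e => dead (fst e) s) L then
    (tl L, (D ++ map (p (fst (snd e))) D, (fst e, 0)))
  else if dead K s then (L, (D, (S K, 0)))
  else if check L D K c then
    ((K, (fst c, snd (snd c))) :: L, (fst (snd c), (S K, 0)))
  else (L, (D, (K, S n))).

Definition crun (s : nat) : cstate :=
  nat_rect (fun _ => cstate) ([], ([], (0, 0))) cstep s.

Lemma comp_coord {A} `{Enc A} (L : A -> list entry) (i x : A -> nat) :
  Computable L -> Computable i -> Computable x ->
  Computable (fun a => coord (L a) (i a) (x a)).
Proof. intros HL Hi Hx. unfold coord, move. comp. Qed.

Lemma comp_check {A} `{Enc A} (L : A -> list entry) (D : A -> list nat) (K : A -> nat)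
    (c : A -> nat * (list nat * list nat)) :
  Computable L -> Computable D -> Computable K -> Computable c ->
  Computable (fun a => check (L a) (D a) (K a) (c a)).
Proof.
  intros HL HD HK Hc. unfold check, topN. comp; apply comp_coord; comp.
Qed.

Lemma comp_crun : Computable crun.
Proof.
  unfold crun, cstep. comp. apply comp_check; comp.
Qed.

Lemma checkP L D K w D' N' : check L D K (w, (D', N')) = true <->
  incl D D' /\ (forall x, In x D -> exists y, In y D' /\ p w y = x) /\
  (forall y, In y D' -> ~ In y N') /\
  incl (topN L) N' /\ (forall x, In x (topN L) -> exists z, In z N' /\ p w z = x) /\
  forall i j g, i <= K -> j <= K -> g <= K ->
    exists y z, In y D' /\ In z N' /\ p g (coord L j y) = coord L i (p w z).
Proof.
  unfold check. cbn [fst snd]. rewrite !andb_true_iff, !forallb_forall.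
  assert (Hm : forall X Y : list nat,
    (forall x, In x X -> mem x Y && mem x (map (p w) Y) = true) <->
    incl X Y /\ forall x, In x X -> exists y, In y Y /\ p w y = x).
  { intros X Y. split.
    - intros H. split; intros x Hx; apply H, andb_true_iff in Hx as [H1 H2].
      + now apply memP.
      + apply memP, in_map_iff in H2 as (y & Hy & Hin). now exists y.
    - intros [H1 H2] x Hx. apply andb_true_iff. rewrite !memP. split; [now apply H1|].
      destruct (H2 x Hx) as (y & Hy & E). apply in_map_iff. now exists y. }
  rewrite !Hm.
  assert (Hd : (forall x, In x D' -> negb (mem x N') = true) <->
    forall y, In y D' -> ~ In y N').
  { split; intros H y Hy; specialize (H y Hy).
    - rewrite <- memP. now destruct (mem y N').
    - rewrite <- memP in H. now destruct (mem y N'). }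
  rewrite Hd.
  match goal with |- _ /\ ?P <-> _ => assert (Ha : P <->
    forall i j g, i <= K -> j <= K -> g <= K ->
    exists y z, In y D' /\ In z N' /\ p g (coord L j y) = coord L i (p w z)) end.
  { rewrite all_ltP. split.
    - intros H i j g Hi Hj Hg. specialize (H i ltac:(lia)). rewrite all_ltP in H.
      specialize (H j ltac:(lia)). rewrite all_ltP in H. specialize (H g ltac:(lia)).
      apply existsb_exists in H as (y & Hy & H). apply existsb_exists in H as (z & Hz & E).
      exists y, z. now apply Nat.eqb_eq in E.
    - intros H i Hi. apply all_ltP. intros j Hj. apply all_ltP. intros g Hg.
      destruct (H i j g) as (y & z & Hy & Hz & E); try lia.
      apply existsb_exists. exists y. split; [easy|]. apply existsb_exists.
      exists z. split; [easy|]. now apply Nat.eqb_eq. }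
  rewrite Ha. tauto.
Qed.

Lemma coord_perm L i : exists g, forall x, p g x = coord L i x.
Proof.
  induction L as [|[k [w N]] L (g & IH)]; [exact (pg_one p Hp)|].
  unfold coord. cbn [fold_left]. unfold move at 2. cbn [fst snd].
  destruct (b k i); [|now exists g].
  destruct (pg_mul p Hp g w) as [g' Hg']. exists g'. intros x. rewrite Hg'. apply IH.
Qed.

Lemma coord_inj L i x y : coord L i x = coord L i y -> x = y.
Proof.
  destruct (coord_perm L i) as [g Hg]. rewrite <- !Hg. now apply perm_inj.
Qed.

Lemma coord_app M L i x : coord (M ++ L) i x = coord L i (coord M i x).
Proof. apply fold_left_app. Qed.

(** Containing the older forbidden set and meeting all its preimages under [w] lets forbidden points
    persist for indices on the right and on the left of the newer cut, respectively. *)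
Fixpoint chain (L : list entry) : Prop :=
  match L with
  | [] => True
  | (_, (w, N)) :: L => incl (topN L) N /\
      (forall x, In x (topN L) -> exists z, In z N /\ p w z = x) /\ chain L
  end.

Fixpoint below (K : nat) (L : list entry) : Prop :=
  match L with [] => True | e :: L => fst e < K /\ below (fst e) L end.

Definition enumerated (st : cstate) (i x : nat) : Prop :=
  exists d, In d (fst (snd st)) /\ coord (fst st) i d = x.

(** Records only what was enumerated for [j]; that the matching point stays out for [i] comes from
    [not_enumerated]. Since [j] is on the right, pushing [e] leaves its coordinates unchanged. *)
Definition separated (st : cstate) (e : entry) (L0 : list entry) : Prop :=
  forall i j g, i <= fst e -> j <= fst e -> g <= fst e -> b (fst e) j = false ->
  exists z v, In z (snd (snd e)) /\ enumerated st j v /\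
    p g v = coord L0 i (p (fst (snd e)) z).

Record invariant (s : nat) (st : cstate) : Prop := {
  inv_chain : chain (fst st);
  inv_disjoint : forall y, In y (fst (snd st)) -> ~ In y (topN (fst st));
  inv_below : below (fst (snd (snd st))) (fst st);
  inv_complete : forall k, k < fst (snd (snd st)) ->
    In k (map fst (fst st)) \/ dead k s = true;
  inv_search : forall n, n < snd (snd (snd st)) ->
    check (fst st) (fst (snd st)) (fst (snd (snd st))) (dec n) = false;
  inv_separated : forall M e L0, fst st = M ++ e :: L0 -> separated st e L0
}.

Lemma below_weaken K K' L : K <= K' -> below K L -> below K' L.
Proof. destruct L as [|e L]; cbn; [easy|]. intros HK [He Hb]. split; [lia|easy]. Qed.

Lemma below_in K L e : below K L -> In e L -> fst e < K.
Proof.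
  revert K. induction L as [|e' L IH]; cbn; [easy|]. intros K [He Hb] [<-|Hin]; [easy|].
  specialize (IH _ Hb Hin). lia.
Qed.

Lemma below_app K M e L : below K (M ++ e :: L) ->
  below (fst e) L /\ fst e < K /\ forall e', In e' M -> fst e < fst e'.
Proof.
  revert K. induction M as [|m M IH]; intros K; cbn.
  - intros [He Hb]. repeat split; trivial. intros _ [].
  - intros [Hm Hb]. destruct (IH _ Hb) as (H1 & H2 & H3).
    repeat split; trivial; [lia|]. intros e' [<-|Hin]; [easy|now apply H3].
Qed.

Lemma cstep_enumerated s st i x :
  enumerated st i x -> enumerated (cstep s st) i x.
Proof.
  destruct st as [L [D [K n]]]. intros (d & Hd & E). cbn [fst snd] in *.
  unfold cstep. cbn [fst snd].
  destruct (existsb (fun e => dead (fst e) s) L) eqn:Edead.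
  - destruct L as [|[k [w N]] L]; [discriminate Edead|]. cbn [hd tl fst snd].
    change (coord L i (move i d (k, (w, N))) = x) in E.
    unfold move in E. cbn [fst snd] in E.
    exists (if b k i then p w d else d). cbn [fst snd]. split.
    + apply in_app_iff. destruct (b k i); [right; now apply in_map|now left].
    + now destruct (b k i).
  - destruct (dead K s); [now exists d|].
    destruct (dec n) as [w [D' N']] eqn:Ec. cbn [fst snd].
    destruct (check L D K (w, (D', N'))) eqn:Echk; [|now exists d].
    apply checkP in Echk as (H1 & H2 & _). unfold enumerated. cbn [fst snd].
    destruct (b K i) eqn:Eb.
    + destruct (H2 d Hd) as (y & Hy & Ey). exists y. split; [easy|].
      change (coord L i (move i y (K, (w, N'))) = x).
      unfold move. cbn [fst snd]. now rewrite Eb, Ey.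
    + exists d. split; [now apply H1|].
      change (coord L i (move i d (K, (w, N'))) = x).
      unfold move. cbn [fst snd]. now rewrite Eb.
Qed.

Lemma separated_cstep s st e L0 :
  separated st e L0 -> separated (cstep s st) e L0.
Proof.
  intros H i j g Hi Hj Hg Hb. destruct (H i j g Hi Hj Hg Hb) as (z & v & Hz & Hv & E).
  exists z, v. split; [easy|]. split; [now apply cstep_enumerated|easy].
Qed.

Lemma invariant_cstep s st : invariant s st -> invariant (S s) (cstep s st).
Proof.
  intros [H1 H2 H3 H4 H5 H6].
  assert (H6' : forall M e L0, fst st = M ++ e :: L0 -> separated (cstep s st) e L0).
  { intros M e L0 E. apply separated_cstep. now apply (H6 M). }
  clear H6. revert H6'. destruct st as [L [D [K n]]]. cbn [fst snd] in *.
  assert (Hmono : forall k, dead k s = true -> dead k (S s) = true).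
  { intros k. apply (cut_mono S0 b dead Hcut). lia. }
  unfold cstep. cbn [fst snd].
  destruct (existsb (fun e => dead (fst e) s) L) eqn:Edead.
  - destruct L as [|[k [w N]] L]; [discriminate Edead|]. cbn [hd tl fst snd].
    intros H6. cbn [chain] in H1. destruct H1 as (H1a & H1b & H1).
    cbn [below fst] in H3. destruct H3 as [H3a H3].
    change (topN ((k, (w, N)) :: L)) with N in H2.
    split; cbn [fst snd]; trivial.
    + intros y Hy HN. apply in_app_iff in Hy as [Hy|Hy].
      * now apply (H2 y), H1a.
      * apply in_map_iff in Hy as (x & <- & Hx). destruct (H1b _ HN) as (z & Hz & E).
        apply (perm_inj p Hp) in E. subst z. now apply (H2 x).
    + intros k' Hk'. destruct (H4 k') as [Hin|Hd]; [lia| |right; now apply Hmono].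
      destruct Hin as [E|Hin]; [cbn in E; lia|now left].
    + intros; lia.
    + intros M e L0 E. apply (H6 ((k, (w, N)) :: M)). cbn. now rewrite E.
  - intros H6. destruct (dead K s) eqn:EK.
    { split; cbn [fst snd]; trivial.
      - now apply (below_weaken K); [lia|].
      - intros k Hk. destruct (Nat.eq_dec k K) as [->|]; [right; now apply Hmono|].
        destruct (H4 k) as [Hin|Hd]; [lia|now left|right; now apply Hmono].
      - intros; lia. }
    revert H6. destruct (dec n) as [w [D' N']] eqn:Ec. cbn [fst snd].
    destruct (check L D K (w, (D', N'))) eqn:Echk; intros H6.
    + pose proof Echk as Ech. apply checkP in Ech as (C1 & C2 & C3 & C4 & C5 & C6).
      split; cbn [fst snd]; trivial.
      * cbn. now repeat split.
      * cbn. now split; [lia|].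
      * intros k Hk. cbn [map fst]. destruct (Nat.eq_dec k K) as [->|]; [left; now left|].
        destruct (H4 k) as [Hin|Hd]; [lia|left; now right|right; now apply Hmono].
      * intros; lia.
      * intros [|m M] e L0 E; cbn in E; injection E as E1 E2.
        -- subst e L0. intros i j g Hi Hj Hg Hb. cbn [fst snd] in *.
           destruct (C6 i j g Hi Hj Hg) as (y & z & Hy & Hz & E).
           exists z, (coord L j y). split; [easy|]. split; [|easy].
           exists y. split; [easy|]. cbn [fst snd].
           change (coord L j (move j y (K, (w, N'))) = coord L j y).
           unfold move. cbn [fst snd]. now rewrite Hb.
        -- now apply (H6 M).
    + split; cbn [fst snd]; trivial.
      * intros k Hk. destruct (H4 k) as [Hin|Hd]; [lia|now left|right; now apply Hmono].
      * intros m Hm. destruct (Nat.eq_dec m n) as [->|]; [now rewrite Ec|].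
        apply H5. lia.
Qed.

Lemma invariant_crun s : invariant s (crun s).
Proof.
  induction s as [|s IH]; [|now apply invariant_cstep].
  split; cbn; trivial; try (intros; lia). intros [|m M] e L0 E; discriminate E.
Qed.

Lemma enumerated_mono s t i x : s <= t ->
  enumerated (crun s) i x -> enumerated (crun t) i x.
Proof.
  intros Hst Hx. induction Hst as [|t Hst IH]; [easy|]. now apply cstep_enumerated.
Qed.

(** A point forbidden by an old entry keeps a forbidden representative in the coordinates of the
    whole stack, so it is never enumerated while that entry is active. *)
Lemma chain_kept_out M L i z : chain (M ++ L) -> In z (topN L) ->
  exists z', In z' (topN (M ++ L)) /\ coord (M ++ L) i z' = coord L i z.
Proof.
  induction M as [|[k [w N]] M IH]; intros Hc Hz; [now exists z|].
  cbn [app chain] in Hc. destruct Hc as (H1 & H2 & Hc).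
  destruct (IH Hc Hz) as (y & Hy & E).
  destruct (b k i) eqn:Eb.
  - destruct (H2 y Hy) as (x & Hx & Ex). exists x. split; [exact Hx|].
    change (coord (M ++ L) i (move i x (k, (w, N))) = coord L i z).
    unfold move. cbn [fst snd]. now rewrite Eb, Ex.
  - exists y. split; [now apply H1|].
    change (coord (M ++ L) i (move i y (k, (w, N))) = coord L i z).
    unfold move. cbn [fst snd]. now rewrite Eb.
Qed.

Lemma not_enumerated s M e L i z : fst (crun s) = M ++ e :: L ->
  In z (snd (snd e)) -> ~ enumerated (crun s) i (coord (e :: L) i z).
Proof.
  intros E Hz (d & Hd & Ed). destruct (invariant_crun s) as [H1 H2 _ _ _ _].
  rewrite E in *.
  destruct (chain_kept_out M (e :: L) i z H1 Hz) as (z' & Hz' & E').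
  rewrite <- E' in Ed. apply coord_inj in Ed. subst d. now apply (H2 z').
Qed.

(** * Limit behaviour of the stack *)

Definition permanent (k : nat) : Prop := forall s, dead k s = false.

Lemma mortal k : ~ permanent k -> exists s, forall t, s <= t -> dead k t = true.
Proof.
  intros HN. apply not_all_ex_not in HN as [s Hs]. exists s. intros t Ht.
  apply (cut_mono S0 b dead Hcut k s t Ht). now destruct (dead k s).
Qed.

Local Notation entries s := (fst (crun s)).
Local Notation core s := (fst (snd (crun s))).
Local Notation bound s := (fst (snd (snd (crun s)))).
Local Notation counter s := (snd (snd (snd (crun s)))).

(** If all of [L0] is permanent, this persists: a pop needs a mortal entry, so it takes one above
    [L0], and [K] falls back only to a number that is at least [k]. *)
Definition stable (k : nat) (L0 : list entry) (s : nat) : Prop :=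
  k <= bound s /\
  exists M, entries s = M ++ L0 /\ forall e, In e M -> k <= fst e.

Definition all_permanent (L : list entry) : Prop :=
  forall e, In e L -> permanent (fst e).

Inductive step_case (s : nat) : Prop :=
| step_pop e (_ : entries s = e :: entries (S s)) (_ : bound (S s) = fst e)
    (_ : ~ all_permanent (entries s))
| step_skip (_ : forall e, In e (entries s) -> dead (fst e) s = false)
    (_ : dead (bound s) s = true)
    (_ : entries (S s) = entries s) (_ : bound (S s) = S (bound s))
| step_push e (_ : forall e, In e (entries s) -> dead (fst e) s = false)
    (_ : dead (bound s) s = false) (_ : fst e = bound s)
    (_ : entries (S s) = e :: entries s) (_ : bound (S s) = S (bound s))
| step_search (_ : forall e, In e (entries s) -> dead (fst e) s = false)
    (_ : dead (bound s) s = false)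
    (_ : entries (S s) = entries s) (_ : core (S s) = core s)
    (_ : bound (S s) = bound s) (_ : counter (S s) = S (counter s)).

Lemma crun_step s : step_case s.
Proof.
  assert (Hstep : crun (S s) = cstep s (crun s)) by reflexivity.
  destruct (existsb (fun e => dead (fst e) s) (entries s)) eqn:Edead.
  - apply existsb_exists in Edead as Hex. destruct Hex as (e' & He' & Hd').
    assert (HN : ~ all_permanent (entries s)).
    { intros Hall. specialize (Hall e' He' s). congruence. }
    destruct (entries s) as [|e L] eqn:EL; [easy|].
    apply (step_pop s e); rewrite ?EL; trivial;
      rewrite Hstep; unfold cstep; rewrite EL, Edead; reflexivity.
  - assert (Hall : forall e, In e (entries s) -> dead (fst e) s = false).
    { intros e He. apply not_true_is_false. intros Hd. apply not_true_iff_false in Edead.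
      apply Edead, existsb_exists. now exists e. }
    destruct (dead (bound s) s) eqn:Ed.
    { apply step_skip; trivial; rewrite Hstep; unfold cstep; rewrite Edead, Ed; reflexivity. }
    destruct (check (entries s) (core s) (bound s) (dec (counter s))) eqn:Ec.
    + eapply (step_push s); trivial; [|rewrite Hstep; unfold cstep; rewrite Edead, Ed, Ec;
        reflexivity|rewrite Hstep; unfold cstep; rewrite Edead, Ed, Ec; reflexivity].
      reflexivity.
    + apply step_search; trivial; rewrite Hstep; unfold cstep; rewrite Edead, Ed, Ec;
        reflexivity.
Qed.

Local Opaque crun.

Lemma stable_S k L0 s : all_permanent L0 -> stable k L0 s -> stable k L0 (S s).
Proof.
  intros HL0 (HK & M & EM & HM).
  destruct (crun_step s) as [e E EK HN|_ _ E EK|e _ _ Ee E EK|_ _ E _ EK _].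
  - rewrite EM in E, HN. destruct M as [|e' M]; [now destruct HN|].
    injection E as <- E. split.
    + rewrite EK. apply HM. now left.
    + exists M. split; [now symmetry|]. intros x Hx. apply HM. now right.
  - split; [rewrite EK; lia|]. exists M. now rewrite E.
  - split; [rewrite EK; lia|]. exists (e :: M). rewrite E, EM. split; [easy|].
    intros x [<-|Hx]; [now rewrite Ee|now apply HM].
  - split; [now rewrite EK|]. exists M. now rewrite E.
Qed.

Lemma stable_mono k L0 s t : all_permanent L0 -> s <= t -> stable k L0 s -> stable k L0 t.
Proof. intros HL0 Hst Hs. induction Hst; [easy|]. now apply stable_S. Qed.

(** As long as [e] is active, nothing below it changes. *)
Lemma suffix_S s M e L : entries s = M ++ e :: L ->
  entries (S s) = L \/ exists M', entries (S s) = M' ++ e :: L.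
Proof.
  intros EM. destruct (crun_step s) as [e' E EK HN|_ _ E _|e' _ _ _ E _|_ _ E _ _ _].
  - rewrite EM in E. destruct M as [|m M]; injection E as _ E; [now left|].
    right. now exists M.
  - right. exists M. now rewrite E.
  - right. exists (e' :: M). now rewrite E, EM.
  - right. exists M. now rewrite E.
Qed.

Lemma pop_dead M : forall s e L, entries s = M ++ e :: L ->
  (forall t, s <= t -> dead (fst e) t = true) -> exists t, s <= t /\ entries t = L.
Proof.
  induction M as [|m M IH]; intros s e L EM Hd.
  all: destruct (crun_step s) as [e' E _ _|Hl _ _ _|e' Hl _ _ _ _|Hl _ _ _ _ _].
  2-4, 6-8: specialize (Hl e); rewrite (Hd s (le_n s)) in Hl;
    discriminate Hl; rewrite EM; apply in_app_iff; right; now left.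
  - rewrite EM in E. injection E as _ E. exists (S s). split; [lia|now symmetry].
  - rewrite EM in E. injection E as _ E. destruct (IH (S s) e L) as (t & Ht & Et).
    + now symmetry.
    + intros t Ht. apply Hd. lia.
    + exists t. split; [lia|easy].
Qed.

Lemma pop_mortal s M e L : entries s = M ++ e :: L -> ~ permanent (fst e) ->
  exists t, s <= t /\ entries t = L.
Proof.
  intros EM HN. destruct (mortal _ HN) as [r Hr].
  assert (Hrun : forall n, (exists t, s <= t /\ entries t = L) \/
    exists M', entries (s + n) = M' ++ e :: L).
  { induction n as [|n [IH|[M' IH]]]; [right; exists M; now rewrite Nat.add_0_r|now left|].
    rewrite Nat.add_succ_r. destruct (suffix_S _ _ _ _ IH) as [E|E]; [|now right].
    left. exists (S (s + n)). split; [lia|easy]. }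
  destruct (Hrun r) as [|[M' E]]; [easy|].
  destruct (pop_dead M' (s + r) e L E) as (t & Ht & Et).
  - intros t Ht. apply Hr. lia.
  - exists t. split; [lia|easy].
Qed.

(** True stages: waiting for a mortal entry of [M] to be popped removes it and everything newer, so
    the part above [L0] gets shorter until only permanent entries remain. *)
Lemma stable_permanent k L0 s : all_permanent L0 -> stable k L0 s ->
  exists t M, s <= t /\ entries t = M ++ L0 /\ all_permanent M /\ forall e, In e M -> k <= fst e.
Proof.
  intros HL0 Hs. pose proof Hs as (_ & M & EM & HM). revert s Hs EM HM.
  induction M as [M IH] using (induction_ltof1 _ (@length entry)). unfold ltof in IH.
  intros s Hs EM HM.
  destruct (classic (all_permanent M)) as [Hall|HN]; [now exists s, M|].
  apply not_all_ex_not in HN as [e HN]. apply imply_to_and in HN as [Hin HN].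
  apply in_split in Hin as (M1 & M2 & ->).
  destruct (pop_mortal s M1 e (M2 ++ L0)) as (t & Ht & Et); [|easy|].
  { now rewrite EM, <- app_assoc. }
  destruct (IH M2) with (s := t) as (u & M' & Hu & HM'); trivial.
  - rewrite length_app. cbn. lia.
  - now apply (stable_mono _ _ s).
  - intros x Hx. apply HM, in_app_iff. right. now right.
  - exists u, M'. split; [lia|easy].
Qed.

Lemma extension_found s : exists n, check (entries s) (core s) (bound s) (dec n) = true.
Proof.
  destruct (invariant_crun s) as [_ Hdis _ _ _ _].
  set (L := entries s) in *. set (D := core s) in *. set (K := bound s).
  destruct (list_choice (fun ijg h => forall x,
    coord L (fst ijg) (p h x) = p (snd (snd ijg)) (coord L (fst (snd ijg)) x))
    (list_prod (seq 0 (S K)) (list_prod (seq 0 (S K)) (seq 0 (S K))))) as [F HF].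
  destruct (extends_exists p Hp D (topN L) F Hinf Hdis) as (w & D' & E1 & E2 & E3 & E4).
  destruct (pg_inv p Hp w) as (k & Hk & Hk').
  (* The new forbidden set has the old one, its preimage under [w], and the preimages under [w] of
     all [h y]; the filter keeps the last family off [D'], and the last clause of [extends]
     guarantees a survivor for each [h]. *)
  exists (enc (w, (D', topN L ++ map (p k) (topN L) ++
    filter (fun z => negb (mem z D')) (flat_map (fun h => map (fun y => p k (p h y)) D') F)))).
  rewrite dec_enc. apply checkP. repeat split; trivial.
  - intros y Hy Hin. destruct (E3 y Hy) as [H1 H2].
    apply in_app_iff in Hin as [Hin|Hin]; [easy|]. apply in_app_iff in Hin as [Hin|Hin].
    + apply in_map_iff in Hin as (x & <- & Hx). now rewrite Hk' in H2.
    + apply filter_In in Hin as [_ Hin]. apply (proj2 (memP y D')) in Hy.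
      now rewrite Hy in Hin.
  - intros x Hx. apply in_app_iff. now left.
  - intros x Hx. exists (p k x). split; [|easy]. apply in_app_iff. right.
    apply in_app_iff. left. now apply in_map.
  - intros i j g Hi Hj Hg. destruct (HF (i, (j, g))) as (h & Hh & Hhx).
    { rewrite !in_prod_iff, !in_seq. lia. }
    { destruct (coord_perm L i) as [a Ha], (coord_perm L j) as [c Hc].
      destruct (pg_inv p Hp a) as (a' & _ & Ha').
      destruct (pg_mul p Hp g c) as [gc Hgc]. destruct (pg_mul p Hp a' gc) as [h Hh].
      exists h. intros x. cbn [fst snd]. now rewrite Hh, Hgc, <- Ha, Ha', Hc. }
    cbn [fst snd] in Hhx. destruct (E4 h Hh) as (y & Hy & Hne).
    exists y, (p k (p h y)). rewrite Hk'. split; [easy|]. split; [|now symmetry].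
    apply in_app_iff. right. apply in_app_iff. right. apply filter_In. split.
    + apply in_flat_map. exists h. split; [easy|]. apply in_map_iff. now exists y.
    + destruct (mem _ D') eqn:Em; [|easy]. apply memP in Em. destruct (Hne _ Em).
      now rewrite Hk'.
Qed.

(** With nothing to pop, skip or push, the configuration would freeze while the counter passes a
    successful candidate, against [inv_search]. *)
Lemma push_found s : (forall t, s <= t -> ~ exists e, entries (S t) = e :: entries s /\
    fst e = bound s) ->
  all_permanent (entries s) -> permanent (bound s) -> False.
Proof.
  intros HN Hall Hperm. destruct (extension_found s) as [n Hn].
  assert (Hstay : forall d, entries (s + d) = entries s /\ core (s + d) = core s /\
    bound (s + d) = bound s /\ counter (s + d) = counter s + d).
  { induction d as [|d (E1 & E2 & E3 & E4)]; [now rewrite !Nat.add_0_r|].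
    rewrite !Nat.add_succ_r.
    destruct (crun_step (s + d)) as [e _ _ HN'|_ Hd _ _|e _ _ Ee E _|_ _ F1 F2 F3 F4].
    - now rewrite E1 in HN'.
    - now rewrite E3, Hperm in Hd.
    - destruct (HN (s + d) ltac:(lia)). exists e.
      split; [now rewrite E, E1|now rewrite Ee].
    - repeat split; [now rewrite F1|now rewrite F2|now rewrite F3|]. rewrite F4, E4. lia. }
  destruct (Hstay (S n)) as (E1 & E2 & E3 & E4).
  pose proof (inv_search _ _ (invariant_crun (s + S n)) n) as Hs.
  rewrite E1, E2, E3, E4, Hn in Hs. discriminate Hs. lia.
Qed.

Lemma entry_at_key k L0 s : stable k L0 s -> In k (map fst (entries s)) ->
  (forall e, In e L0 -> fst e < k) ->
  exists M e, entries s = M ++ e :: L0 /\ fst e = k.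
Proof.
  intros (HK & M & EM & HM) Hin HL0.
  apply in_map_iff in Hin as (e & Ee & Hin). rewrite EM in Hin.
  apply in_app_iff in Hin as [Hin|Hin]; [|specialize (HL0 e Hin); lia].
  apply in_split in Hin as (M1 & M2 & ->). exists M1, e. split; [|easy].
  rewrite EM, <- app_assoc. cbn. do 2 f_equal.
  destruct M2 as [|e2 M2]; [easy|exfalso].
  pose proof (inv_below _ _ (invariant_crun s)) as Hb. rewrite EM, <- app_assoc in Hb.
  apply below_app in Hb as [Hb _]. cbn in Hb. destruct Hb as [Hb _].
  specialize (HM e2). rewrite in_app_iff in HM. cbn in HM. specialize (HM ltac:(tauto)). lia.
Qed.

(** Finite-injury induction on [k]: [L0] is the final stack of the permanent cuts below [k]. A
    permanent [k] is eventually pushed right above it and stays; a mortal [k] is eventually absent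
    for good. *)
Lemma stable_exists k : exists L0 s, stable k L0 s /\ all_permanent L0 /\
  (forall e, In e L0 -> fst e < k) /\
  forall k', k' < k -> permanent k' -> In k' (map fst L0).
Proof.
  induction k as [|k (L0 & s0 & Hs0 & HL0 & Hlt & Hcomp)].
  { exists [], 0. split; [split; [lia|]|]; [|split; [easy|split; [easy|intros; lia]]].
    exists (entries 0). rewrite app_nil_r. split; [easy|]. intros; lia. }
  destruct (classic (permanent k)) as [Hperm|HN].
  - assert (He : exists s e M, entries s = M ++ e :: L0 /\ fst e = k).
    { destruct (le_lt_dec (bound s0) k) as [L|L].
      - pose proof Hs0 as (HK & M & EM & HM).
        assert (EK : bound s0 = k) by lia.
        assert (M = []) as ->.
        { destruct M as [|m M]; [easy|exfalso]. specialize (HM m (or_introl eq_refl)).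
          pose proof (inv_below _ _ (invariant_crun s0)) as Hb.
          apply below_in with (e := m) in Hb; [lia|]. rewrite EM. now left. }
        apply NNPP. intros HN. apply (push_found s0).
        + intros t _ (e & Ee & Ek). apply HN. exists (S t), e, [].
          split; [now rewrite Ee, EM|congruence].
        + now rewrite EM.
        + now rewrite EK.
      - destruct (inv_complete _ _ (invariant_crun s0) k L) as [Hin|Hd].
        + destruct (entry_at_key k L0 s0 Hs0 Hin Hlt) as (M & e & E & Ee).
          now exists s0, e, M.
        + now rewrite Hperm in Hd. }
    destruct He as (s & e & M & EM & Ee).
    pose proof (inv_below _ _ (invariant_crun s)) as Hb. rewrite EM in Hb.
    apply below_app in Hb as (_ & HK & HM). rewrite Ee in HK, HM.
    exists (e :: L0), s. split; [|split; [|split]].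
    + split; [exact HK|]. exists M. split; [easy|]. intros x Hx. apply HM in Hx. lia.
    + intros x [<-|Hx]; [now rewrite Ee|now apply HL0].
    + intros x [<-|Hx]; [lia|]. specialize (Hlt x Hx). lia.
    + intros k' Hk' Hp'. cbn. destruct (Nat.eq_dec k' k) as [->|]; [now left|].
      right. apply Hcomp; [lia|easy].
  - assert (Hs : exists s, stable (S k) L0 s).
    { destruct (mortal k HN) as [r Hr].
      assert (Hs1 : stable k L0 (s0 + r)) by (apply (stable_mono _ _ s0); trivial; lia).
      assert (Hnext : forall s, s0 + r <= s -> stable k L0 s -> bound s = k ->
        exists s, stable (S k) L0 s).
      { intros s Hsr (_ & M & EM & HM) EK. exists (S s).
        assert (M = []) as ->.
        { destruct M as [|m M]; [easy|exfalso]. specialize (HM m (or_introl eq_refl)).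
          pose proof (inv_below _ _ (invariant_crun s)) as Hb.
          apply below_in with (e := m) in Hb; [lia|]. rewrite EM. now left. }
        assert (Hdk : dead (bound s) s = true) by (rewrite EK; apply Hr; lia).
        cbn in EM.
        destruct (crun_step s) as [e _ _ HN'|_ _ E E'|e _ Hd _ _ _|_ Hd _ _ _ _].
        - now rewrite EM in HN'.
        - split; [lia|]. exists []. split; [now rewrite E|easy].
        - congruence.
        - congruence. }
      destruct (Nat.eq_dec (bound (s0 + r)) k) as [EK|NK].
      { now apply (Hnext (s0 + r)). }
      pose proof Hs1 as (HK & M & EM & HM).
      destruct (classic (In k (map fst (entries (s0 + r))))) as [Hin|Hnin].
      - destruct (entry_at_key k L0 (s0 + r) Hs1 Hin Hlt) as (M' & e & E & Ee).
        clear M EM HM.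
        (* Once [k] is dead, every stage is a pop until its entry goes; [K] is then [k], and the
           next stage skips it. *)
        assert (Hpop : forall M' s, s0 + r <= s -> entries s = M' ++ e :: L0 ->
          exists t, s0 + r <= t /\ entries t = L0 /\ bound t = k).
        { clear M' E. induction M' as [|m M' IH]; intros s Hsr E.
          all: destruct (crun_step s) as [e' F F' _|Hl _ _ _|e' Hl _ _ _ _|Hl _ _ _ _ _].
          2-4, 6-8: specialize (Hl e); rewrite Ee, Hr in Hl by lia;
            discriminate Hl; rewrite E; apply in_app_iff; right; now left.
          - rewrite E in F. injection F as <- F. exists (S s).
            split; [lia|]. split; [now symmetry|congruence].
          - rewrite E in F. injection F as _ F. apply (IH (S s)); [lia|now symmetry]. }
        destruct (Hpop M' (s0 + r) (le_n _) E) as (t & Ht & _ & EK).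
        apply (Hnext t Ht); [|easy]. now apply (stable_mono _ _ (s0 + r)).
      - exists (s0 + r). split; [lia|]. exists M. split; [easy|].
        intros e He. specialize (HM e He).
        enough (fst e <> k) by lia. intros Ee. apply Hnin. rewrite EM, map_app, in_app_iff.
        left. apply in_map_iff. now exists e. }
    destruct Hs as [s Hs]. exists L0, s. split; [easy|]. split; [easy|]. split.
    + intros e He. specialize (Hlt e He). lia.
    + intros k' Hk' Hp'. destruct (Nat.eq_dec k' k) as [->|]; [easy|].
      apply Hcomp; [lia|easy].
Qed.

(** * The coded sets and the relation between them *)

Definition coded (i x : nat) : Prop := exists s, enumerated (crun s) i x.

(** Past [k] no permanent cut separates [i] from [j], so at true stages their coordinates differ
    only through [L0]. The permutation [g] undoes the [L0]-part for [i] and applies the one for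
    [j]. *)
Lemma coded_related i j : S0 i j -> exists g, forall x, coded i x <-> coded j (p g x).
Proof.
  intros HS. destruct (cut_rel S0 b dead Hcut i j HS) as [k Hk].
  destruct (stable_exists k) as (L0 & s0 & Hs0 & HL0 & _).
  assert (Hlate : forall s, exists t M, s <= t /\ entries t = M ++ L0 /\
    forall d, coord M i d = coord M j d).
  { intros s. destruct (stable_permanent k L0 (s0 + s) HL0) as (t & M & Ht & EM & HM & HMk).
    { apply (stable_mono _ _ s0); trivial. lia. }
    exists t, M. split; [lia|]. split; [easy|]. clear EM.
    induction M as [|e M IH]; [easy|]. intros d.
    change (coord M i (move i d e) = coord M j (move j d e)). rewrite IH.
    - unfold move. rewrite (Hk (fst e)); [easy| |].
      + apply HMk. now left.
      + apply HM. now left.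
    - intros x Hx. apply HM. now right.
    - intros x Hx. apply HMk. now right. }
  destruct (coord_perm L0 i) as [a Ha], (coord_perm L0 j) as [c Hc].
  destruct (pg_inv p Hp a) as (a' & Ha' & _). destruct (pg_mul p Hp c a') as [g Hg].
  exists g.
  assert (Hgc : forall x, p g (coord L0 i x) = coord L0 j x).
  { intros x. now rewrite Hg, <- Ha, Ha', Hc. }
  intros x. split; intros [s Hx]; destruct (Hlate s) as (t & M & Ht & EM & Hbit);
    apply (enumerated_mono s t _ _ Ht) in Hx; destruct Hx as (d & Hd & E);
    rewrite EM, coord_app in E; exists t, d; (split; [easy|]); rewrite EM, coord_app.
  - now rewrite <- E, Hbit, Hgc.
  - apply (perm_inj p Hp g). now rewrite <- E, Hgc, Hbit.
Qed.

(** From some stage on the entry of [k] is never popped. The point [v] found when it was pushed is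
    in the set of [j], while its image under [g] is kept out of the set of [i] at every later
    stage. *)
Lemma coded_separated k i j g : permanent k -> i <= k -> j <= k -> g <= k ->
  b k j = false -> b k i = true -> ~ forall x, coded j x -> coded i (p g x).
Proof.
  intros Hk Hi Hj Hg Hbj Hbi Hx.
  destruct (stable_exists (S k)) as (L0 & s & Hs & HL0 & _ & Hcomp).
  specialize (Hcomp k (Nat.lt_succ_diag_r k) Hk).
  apply in_map_iff in Hcomp as (e & Ee & He). apply in_split in He as (L1 & L2 & ->).
  assert (Hsuf : forall t, s <= t -> exists M, entries t = M ++ e :: L2).
  { intros t Ht. apply (stable_mono _ _ s t HL0 Ht) in Hs as (_ & M & EM & _).
    exists (M ++ L1). now rewrite EM, <- app_assoc. }
  destruct (Hsuf s (le_n s)) as [M EM].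
  destruct (inv_separated _ _ (invariant_crun s) M e L2 EM i j g) as (z & v & Hz & Hv & E);
    rewrite ?Ee; trivial.
  destruct (Hx v) as [t Ht]; [now exists s|].
  apply (enumerated_mono t (s + t)) in Ht; [|lia].
  destruct (Hsuf (s + t)) as [M' EM']; [lia|].
  apply (not_enumerated (s + t) M' e L2 i z EM' Hz).
  enough (Ec : p g v = coord (e :: L2) i z) by exact (eq_ind _ _ Ht _ Ec).
  rewrite E. change (coord L2 i (p (fst (snd e)) z) = coord L2 i (move i z e)).
  unfold move. now rewrite Ee, Hbi.
Qed.

Lemma coded_unrelated i j : ~ S0 i j -> ~ exists g, forall x, coded i x <-> coded j (p g x).
Proof.
  intros HN [g Hg]. destruct (pg_inv p Hp g) as (g' & _ & Hg').
  (* Either of [i] and [j] may be on the left of the cut, so both [g] and its inverse must be among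
     the elements diagonalised against. *)
  destruct (cut_nrel S0 b dead Hcut i j HN (i + j + g + g')) as (k & Hk & Hperm & Hb).
  destruct (b k i) eqn:Ei, (b k j) eqn:Ej; try congruence.
  - apply (coded_separated k i j g'); trivial; try lia.
    intros x Hx. apply Hg. now rewrite Hg'.
  - apply (coded_separated k j i g); trivial; try lia.
    intros x Hx. now apply Hg.
Qed.

Lemma cut_form_reducible_orbit : reducible S0 (perm_orbit p).
Proof.
  destruct (ce_family (fun i x s => mem x (map (coord (entries s) i) (core s))))
    as (f & Hf & HW).
  { pose proof comp_crun. comp. apply comp_coord; comp. }
  exists f. split; [now apply Computable_computable|].
  assert (HWc : forall i x, W (f i) x <-> coded i x).
  { intros i x. rewrite HW. split; intros [s Hs]; exists s.
    - apply memP, in_map_iff in Hs as (d & E & Hd). now exists d.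
    - apply memP, in_map_iff. destruct Hs as (d & Hd & E). now exists d. }
  intros i j. unfold perm_orbit. setoid_rewrite HWc. split; [apply coded_related|].
  intros Hg. apply NNPP. intros HN. now apply (coded_unrelated i j).
Qed.

End Coding.

(** * The dichotomy *)

Lemma perm_orbit_cut_form p : perm_group p -> exists b dead, cut_form (perm_orbit p) b dead.
Proof.
  intros Hp. pose proof (pg_comp p Hp) as p_comp.
  apply (cut_form_sigma3 _
    (fun i j g xr s => agree i j (pi1 xr) (p g (pi1 xr)) (pi2 xr) s)).
  - intros i. destruct (pg_one p Hp) as [e He]. exists e. intros x. now rewrite He.
  - intros i j [g Hg]. destruct (pg_inv p Hp g) as (k & _ & Hk). exists k.
    intros x. now rewrite Hg, Hk.
  - intros i j k [g Hg] [h Hh]. destruct (pg_mul p Hp h g) as [l Hl]. exists l.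
    intros x. now rewrite Hl, Hg, Hh.
  - apply comp_agree; comp.
  - intros i j. split; intros [g Hg]; exists g.
    + intros xr. now apply agreeP.
    + intros x. apply agreeP. intros r. destruct (Hg (cpair x r)) as [s Hs].
      rewrite pi1_cpair, pi2_cpair in Hs. now exists s.
Qed.

(** If each candidate failed at some [n], it would fail from there on, and no candidate would be
    left at a large [n]. *)
Lemma downward_pigeonhole {X} (P : nat -> X -> Prop) (l : list X) :
  (forall m n r, m <= n -> P n r -> P m r) ->
  (forall n, exists r, In r l /\ P n r) -> exists r, In r l /\ forall n, P n r.
Proof.
  intros Hdown. induction l as [|r l IH]; intros HP; [now destruct (HP 0) as (r & [] & _)|].
  destruct (classic (forall n, P n r)) as [Hall|HN]; [exists r; now split; [left|]|].
  apply not_all_ex_not in HN as [m Hm]. destruct IH as (r' & Hr' & HP').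
  - intros n. destruct (HP (m + n)) as (r' & [<-|Hr'] & HP').
    + destruct Hm. apply (Hdown m (m + n)); [lia|easy].
    + exists r'. split; [easy|]. apply (Hdown n (m + n)); [lia|easy].
  - exists r'. now split; [right|].
Qed.

(** * Groups inducing finitely many permutations *)

Section FiniteImage.
Variable p : nat -> nat -> nat.
Hypothesis Hp : perm_group p.
Variable l : list nat.
Hypothesis Hl : forall g, exists h, In h l /\ forall x, p g x = p h x.

Let p_comp := pg_comp p Hp.

Lemma finite_order k : exists m, forall x, Nat.iter (S m) (p k) x = x.
Proof.
  assert (Hpow : forall n, exists g, forall x, p g x = Nat.iter n (p k) x).
  { induction n as [|n [g IH]]; [exact (pg_one p Hp)|].
    destruct (pg_mul p Hp k g) as [h Hh]. exists h. intros x. cbn. now rewrite Hh, IH. }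
  destruct (downward_pigeonhole (fun n r => exists m, n <= m /\
    forall x, Nat.iter m (p k) x = p r x) l) as (r & _ & Hr).
  - intros m n r Hmn (q & Hq & E). exists q. split; [lia|easy].
  - intros n. destruct (Hpow n) as [g Hg]. destruct (Hl g) as (h & Hh & E).
    exists h. split; [easy|]. exists n. split; [easy|]. intros x. now rewrite <- Hg.
  - destruct (Hr 0) as (a & _ & Ha). destruct (Hr (S a)) as (c & Hac & Hc).
    exists (c - S a). intros x. destruct (Hpow a) as [g Hg]. apply (perm_inj p Hp g).
    rewrite !Hg, <- nat_iter_add. replace (S (c - S a) + a) with c by lia.
    now rewrite Hc, Ha.
Qed.

Lemma finite_image_reducible_eq : reducible (perm_orbit p) eq_ce.
Proof.
  destruct (ce_family (fun i F s => existsb (fun r =>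
    forallb (fun x => Wst i (p r x) s) (dec F : list nat)) l)) as (f & Hf & HW); [comp|].
  exists f. split; [now apply Computable_computable|].
  assert (HWf : forall i F, W (f i) F <->
    exists r, forall x, In x (dec F : list nat) -> W i (p r x)).
  { intros i F. rewrite HW. split.
    - intros [s Hs]. apply existsb_exists in Hs as (r & _ & Hs). exists r. intros x Hx.
      apply W_Wst. exists s. now apply (proj1 (forallb_forall _ _) Hs).
    - intros [r Hr]. destruct (Hl r) as (h & Hh & E).
      assert (Hs : exists s, forall x, In x (dec F : list nat) -> Wst i (p h x) s = true).
      { induction (dec F : list nat) as [|y F' IH]; [now exists 0|].
        destruct IH as [s Hs]; [intros x Hx; apply Hr; now right|].
        destruct (proj1 (W_Wst _ _) (Hr y (or_introl eq_refl))) as [t Ht].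
        exists (s + t). intros x [<-|Hx].
        - apply (Wst_mono _ _ t); [lia|]. now rewrite <- E.
        - apply (Wst_mono _ _ s); [lia|]. now apply Hs. }
      destruct Hs as [s Hs]. exists s. apply existsb_exists. exists h.
      split; [easy|]. now apply forallb_forall. }
  assert (Hsub : forall i j g, (forall x, W i x -> W j (p g x)) ->
    forall F, W (f i) F -> W (f j) F).
  { intros i j g Hg F HF. apply HWf in HF as [r Hr]. destruct (pg_mul p Hp g r) as [k Hk].
    apply HWf. exists k. intros x Hx. rewrite Hk. now apply Hg, Hr. }
  assert (Hemb : forall i j, eq_ce (f i) (f j) -> exists g, forall x, W i x -> W j (p g x)).
  (* Compactness: each initial part of [W i] is itself a finite set tested by [f], hence has a
     translate inside [W j], and one of the finitely many permutations serves all parts. *)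
  { intros i j E. destruct (downward_pigeonhole (fun n r =>
      forall x, x < n -> W i x -> W j (p r x)) l) as (r & _ & Hr).
    - intros m n r Hmn H x Hx. apply H. lia.
    - intros n. destruct (list_filter (W i) (seq 0 n)) as [F HF].
      destruct (proj1 (HWf j (enc F))) as [r Hr].
      + apply E, HWf. rewrite dec_enc. destruct (pg_one p Hp) as [e He]. exists e.
        intros x Hx. rewrite He. now apply HF.
      + destruct (Hl r) as (h & Hh & Eh). exists h. split; [easy|]. intros x Hx Hix.
        rewrite <- Eh. apply Hr. rewrite dec_enc. apply HF. split; [|easy].
        apply in_seq. lia.
    - exists r. intros x. apply (Hr (S x)). lia. }
  intros i j. split.
  - intros [g Hg] F. split.
    + apply (Hsub i j g). intros x. apply Hg.
    + destruct (pg_inv p Hp g) as (k & _ & Hk). apply (Hsub j i k). intros x Hx.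
      apply Hg. now rewrite Hk.
  - intros E. destruct (Hemb i j E) as [g Hg].
    destruct (Hemb j i) as [h Hh]; [intros x; symmetry; apply E|].
    exists g. intros x. split; [apply Hg|]. intros Hx.
    (* Two embeddings give an equality: [k], the composite of [g] and then [h], maps [W i] into
       itself and its power [S m] is the identity, so [m] further applications lead from [k x] back
       to [x] inside [W i]. *)
    destruct (pg_mul p Hp h g) as [k Hk]. destruct (finite_order k) as [m Hm].
    rewrite <- (Hm x), nat_iter_S. apply Hh in Hx. rewrite <- Hk in Hx.
    revert Hx. generalize (p k x). clear - Hg Hh Hk.
    induction m as [|m IH]; intros y Hy; [easy|]. rewrite nat_iter_S. apply IH.
    rewrite Hk. now apply Hh, Hg.
Qed.

Lemma eq_reducible_finite_image : reducible eq_ce (perm_orbit p).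
Proof.
  set (sup y := fold_left (fun acc g => Nat.max acc (p g y)) l 0).
  (* Each value of [t] exceeds all translates of the previous one, so no permutation of the group
     sends [t r] to [t r'] for distinct [r] and [r']. *)
  set (t r := nat_rect (fun _ => nat) 0 (fun _ y => S (sup y)) r).
  assert (Hsup : forall g y, p g y <= sup y).
  { intros g y. destruct (Hl g) as (h & Hh & E). rewrite E. unfold sup. clear E. clear g.
    enough (HP : forall acc, acc <= fold_left (fun acc g => Nat.max acc (p g y)) l acc /\
      p h y <= fold_left (fun acc g => Nat.max acc (p g y)) l acc) by apply HP.
    clear Hl p_comp Hp. revert Hh. generalize l.
    assert (Hge : forall l' acc, acc <= fold_left (fun acc g => Nat.max acc (p g y)) l' acc).
    { induction l' as [|g l' IH]; intros acc; cbn; [lia|].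
      specialize (IH (Nat.max acc (p g y))). lia. }
    induction l0 as [|g l' IH]; [easy|]. intros [<-|Hh] acc; (split; [apply Hge|]); cbn.
    - specialize (Hge l' (Nat.max acc (p g y))). lia.
    - now apply IH. }
  assert (Ht : forall g r r', r < r' -> p g (t r) < t r').
  { intros g r r' Hr. induction Hr as [|r' Hr IH].
    - change (t (S r)) with (S (sup (t r))). specialize (Hsup g (t r)). lia.
    - change (t (S r')) with (S (sup (t r'))). destruct (pg_one p Hp) as [e He].
      specialize (Hsup e (t r')). rewrite He in Hsup. lia. }
  destruct (ce_family (fun i x s => ex_lt s (fun r => Nat.eqb (t r) x && Wst i r s)))
    as (f & Hf & HW).
  { unfold t, sup. comp. }
  assert (HWf : forall i x, W (f i) x <-> exists r, t r = x /\ W i r).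
  { intros i x. rewrite HW. split.
    - intros [s Hs]. apply ex_ltP in Hs as (r & _ & Hs). apply andb_true_iff in Hs as [E Hs].
      apply Nat.eqb_eq in E. exists r. split; [easy|]. apply W_Wst. now exists s.
    - intros (r & E & Hr). apply W_Wst in Hr as [s Hs]. exists (S (r + s)).
      apply ex_ltP. exists r. split; [lia|]. apply andb_true_iff. split.
      + now apply Nat.eqb_eq.
      + apply (Wst_mono _ _ s); [lia|easy]. }
  assert (Hinj : forall g r r', p g (t r) = t r' -> r = r').
  { intros g r r' E. destruct (lt_eq_lt_dec r r') as [[L|]|L]; [|easy|].
    - specialize (Ht g r r' L). lia.
    - destruct (pg_inv p Hp g) as (k & Hk & _). specialize (Ht k r' r L).
      rewrite <- E, Hk in Ht. lia. }
  exists f. split; [now apply Computable_computable|]. intros i j. split.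
  - intros E. destruct (pg_one p Hp) as [e He]. exists e. intros x. rewrite He, !HWf.
    split; intros (r & Er & Hr); exists r; (split; [easy|]); now apply E.
  - intros [g Hg] r. split; intros Hr.
    + destruct (proj1 (HWf j (p g (t r)))) as (r' & E & Hr').
      { apply Hg, HWf. now exists r. }
      symmetry in E. apply Hinj in E. now subst.
    + destruct (pg_inv p Hp g) as (k & _ & Hk).
      destruct (proj1 (HWf i (p k (t r)))) as (r' & E & Hr').
      { apply Hg. rewrite Hk. apply HWf. now exists r. }
      symmetry in E. apply Hinj in E. now subst.
Qed.

End FiniteImage.

Lemma reducible_trans E F G : reducible E F -> reducible F G -> reducible E G.
Proof.
  intros (f & Hf & HEF) (g & Hg & HFG). apply Computable_computable in Hf, Hg.
  exists (fun x => g (f x)). split.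
  - apply Computable_computable. comp.
  - intros x y. now rewrite HEF, HFG.
Qed.

Lemma bireducible_orbit_dichotomy p : perm_group p ->
  bireducible (perm_orbit p) eq_ce \/ bireducible (perm_orbit p) E0_ce.
Proof.
  intros Hp. destruct (classic (infinite_image p)) as [Hinf|HN].
  - right. split.
    + destruct (perm_orbit_cut_form p Hp) as (b & dead & Hcut).
      exact (cut_form_reducible_E0 _ b dead Hcut).
    + destruct cut_form_E0 as (b & dead & Hcut).
      exact (cut_form_reducible_orbit p Hp Hinf _ b dead Hcut).
  - left. apply not_all_ex_not in HN as [l HN].
    assert (Hl : forall g, exists h, In h l /\ forall x, p g x = p h x).
    { intros g. apply NNPP. intros HN2. apply HN. exists g. intros h Hh.
      apply not_all_ex_not. intros Hall. apply HN2. now exists h. }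
    split.
    + now apply (finite_image_reducible_eq p Hp l).
    + now apply (eq_reducible_finite_image p Hp l).
Qed.

Theorem mainTheorem1 (E : nat -> nat -> Prop) (hE : ce_orbit_equivalence E) :
  (bireducible E eq_ce \/ bireducible E E0_ce) /\
  ~ (bireducible E eq_ce /\ bireducible E E0_ce).
Proof.
  split.
  - destruct (orbit_equivalence_perm E hE) as (p & Hp & HE).
    assert (Hcongr : forall F, bireducible (perm_orbit p) F -> bireducible E F).
    { intros F [(f & Hf & H1) (g & Hg & H2)]. split.
      - exists f. split; [easy|]. intros x y. now rewrite HE.
      - exists g. split; [easy|]. intros x y. now rewrite HE. }
    destruct (bireducible_orbit_dichotomy p Hp); [left|right]; now apply Hcongr.
  - intros [[HE _] [_ HE0]]. apply E0_not_reducible_eq.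
    exact (reducible_trans _ _ _ HE0 HE).
Qed.
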